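(* Let $n \ge 9$. The stabilizer problem on $\mathbb{Q}^n$ is undecidable: there is no algorithm which, given as input a finite set $X \subset \mathrm{GL}_n(\mathbb{Q})$ and a vector $u \in \mathbb{Q}^n$, decides whether the stabilizer $\{ g \in \langle X \rangle : gu = u\}$ of $u$ in the group $\langle X\rangle$ generated by $X$ is the trivial group.
   Context: Matrices and vectors are given by their rational entries. ''Undecidable'' means that no algorithm (Turing machine) solves the problem for all inputs. *)

(* Defs.v *)
From HB Require Import structures.
From mathcomp Require Import all_boot all_order all_algebra.
Set Implicit Arguments. Unset Strict Implicit. Unset Printing Implicit Defensive.
Import GRing.Theory Num.Theory.
Local Open Scope ring_scope.

Inductive prf : Type :=
| PZero : prf
| PSucc : prf
| PProj : nat -> prf
| PComp : prf -> seq prf -> prf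
| PPrim : prf -> prf -> prf
| PMu   : prf -> prf.

Inductive prf_eval : prf -> seq nat -> nat -> Prop :=
| ev_zero v : prf_eval PZero v 0
| ev_succ x v : prf_eval PSucc (x :: v) x.+1
| ev_proj i v : (i < size v)%N -> prf_eval (PProj i) v (nth 0%N v i)
| ev_comp f gs v ys z :
    prf_evals gs v ys -> prf_eval f ys z -> prf_eval (PComp f gs) v z
| ev_prim0 f g v z : prf_eval f v z -> prf_eval (PPrim f g) (0%N :: v) z
| ev_primS f g k v y z :
    prf_eval (PPrim f g) (k :: v) y -> prf_eval g (k :: y :: v) z ->
    prf_eval (PPrim f g) (k.+1 :: v) z
| ev_mu f v k :
    prf_eval f (k :: v) 0%N ->
    (forall m, (m < k)%N -> exists j, prf_eval f (m :: v) j.+1) ->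
    prf_eval (PMu f) v k
with prf_evals : seq prf -> seq nat -> seq nat -> Prop :=
| evs_nil v : prf_evals [::] v [::]
| evs_cons g gs v y ys :
    prf_eval g v y -> prf_evals gs v ys -> prf_evals (g :: gs) v (y :: ys).

Definition decidable_promise (T : countType) (promise : T -> Prop) (P : T -> Prop) : Prop :=
  exists f : prf, forall x : T, promise x ->
    (P x -> prf_eval f [:: pickle x] 1%N) /\ (~ P x -> prf_eval f [:: pickle x] 0%N).

Inductive in_gen (n : nat) (X : seq 'M[rat]_n) : 'M[rat]_n -> Prop :=
| gen_one : in_gen X 1%:M
| gen_mul x g : x \in X -> in_gen X g -> in_gen X (x *m g)
| gen_mulV x g : x \in X -> in_gen X g -> in_gen X (invmx x *m g).

Definition stabilizer_trivial (n : nat) (X : seq 'M[rat]_n) (u : 'cV[rat]_n) : Prop :=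
  forall g, in_gen X g -> g *m u = u -> g = 1%:M.

Definition stab_input (n : nat) : countType := (seq 'M[rat]_n * 'cV[rat]_n)%type.

Definition stab_promise (n : nat) (i : stab_input n) : Prop :=
  all (fun x => x \in unitmx) i.1.

Definition stab_trivial_problem (n : nat) (i : stab_input n) : Prop :=
  stabilizer_trivial i.1 i.2.

(* Main.v *)
Require Import Defs.
From mathcomp Require Import all_boot all_order all_algebra.
From mathcomp Require Import boolp zify ring lra.
Set Implicit Arguments. Unset Strict Implicit. Unset Printing Implicit Defensive.
Import Order.TTheory GRing.Theory Num.Theory.

(** A recursive function is turned into a finite set of rules [m v + r |-> A v + B]
    on integers (registers are exponents of primes), so that halting becomes
    reachability of a fixed integer [h].  These rules define a group
      H = < x, u, t, k_j | k_j x^m = x^A k_j,  k_j t(r) = t(B) k_j,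
                           [u, k_j] = [u, t(h)] = 1 >,   t(n) = x^-n t x^n,
    in which [u] commutes with [t(n)] as soon as [n] reaches [h].  Conversely, if
    [n] does not reach [h], a permutation representation of [H], in which the
    [k_j] preserve a colouring of the sites recording reachability, separates
    [t(n)] from the nontrivial powers of [u].

    The free group on the generators embeds in GL_2(Q) by ping-pong, in such a way
    that the stabilizer of [v_n = x^n v_0] is generated by [x^n u x^-n].  As in
    Mikhailova's construction, the pairs [(a, b)] with [a = t b t^-1] in [H] form a
    finitely generated subgroup of GL_2(Q) x GL_2(Q), and the stabilizer of
    [(v_n, v_n)] in it is trivial iff [n] does not reach [h].

    Only the vector depends on [n], so no universal machine is needed: given a
    decision procedure, a machine that runs it on its own instance (whose
    generators it receives as input) contradicts it. *)

(** * Compiling recursive functions to loop programs *)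

Definition store := nat -> nat.

Definition upd (s : store) r v : store := fun q => if q == r then v else s q.

(** [CLoop r c] is a while loop: as long as [r] is nonzero, it is decremented and [c] is run. Since
    [c] may write to [r], unbounded search is expressible. *)
Inductive cmd : Type :=
| CInc : nat -> cmd
| CClear : nat -> cmd
| CSeq : cmd -> cmd -> cmd
| CLoop : nat -> cmd -> cmd.

Inductive exec : cmd -> store -> store -> Prop :=
| ex_inc r s : exec (CInc r) s (upd s r (s r).+1)
| ex_clear r s : exec (CClear r) s (upd s r 0)
| ex_seq c d s1 s2 s3 : exec c s1 s2 -> exec d s2 s3 -> exec (CSeq c d) s1 s3
| ex_loop0 r c s : s r = 0 -> exec (CLoop r c) s s
| ex_loopS r c s n s1 s2 : s r = n.+1 -> exec c (upd s r n) s1 ->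
    exec (CLoop r c) s1 s2 -> exec (CLoop r c) s s2.

Lemma exec_eqr c s s1 s2 : exec c s s1 -> s1 =1 s2 -> exec c s s2.
Proof. by move=> h /funext <-. Qed.

Ltac store_ext :=
  let q := fresh "q" in
  move=> q; rewrite /upd /=; repeat (case: eqP => ? //=; subst; try lia);
  try congruence; try lia.

Definition cmove r t := CLoop r (CInc t).

Lemma exec_move r t s : r != t ->
  exec (cmove r t) s (upd (upd s t (s t + s r)) r 0).
Proof.
move=> /eqP nrt; have [n h] : exists n, s r = n by exists (s r).
elim: n s h => [|n IH] s h.
  by apply: exec_eqr (ex_loop0 _ h) _; store_ext.
apply: (ex_loopS h (ex_inc _ _)); apply: (exec_eqr (IH _ _)); last by store_ext.
by rewrite /upd; case: eqP => [e|_]; [congruence|rewrite eqxx].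
Qed.

Definition ccopy r t tmp := CSeq (CLoop r (CSeq (CInc tmp) (CInc t))) (cmove tmp r).

Lemma exec_copy r t tmp s : r != t -> r != tmp -> t != tmp -> s tmp = 0 ->
  exec (ccopy r t tmp) s (upd s t (s t + s r)).
Proof.
move=> /eqP n1 /eqP n2 /eqP n3 h0.
have h : exec (CLoop r (CSeq (CInc tmp) (CInc t))) s
   (upd (upd (upd s t (s t + s r)) tmp (s tmp + s r)) r 0).
  have [n h] : exists n, s r = n by exists (s r).
  elim: n s h {h0} => [|n IH] s h.
    by apply: exec_eqr (ex_loop0 _ h) _; store_ext.
  apply: (ex_loopS h (ex_seq (ex_inc _ _) (ex_inc _ _))).
  apply: (exec_eqr (IH _ _)); last by store_ext.
  by rewrite /upd /=; do ! case: eqP => ? //=; congruence.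
apply: ex_seq h _; apply: (exec_eqr (exec_move _ _)); first by apply/eqP; congruence.
by store_ext.
Qed.

Definition cseqs (cs : seq cmd) (c : cmd) := foldr CSeq c cs.

(** Arguments are read from the registers [args], the result goes to [out], and the registers from
    [fr] on are scratch, zero on entry and again on exit. In [PComp], the commands [CClear out] and
    [CClear fr] only terminate the sequences. *)
Fixpoint compile (f : prf) (args : seq nat) (out fr : nat) : cmd :=
  match f with
  | PZero => CClear out
  | PSucc => CSeq (ccopy (head 0 args) out fr) (CInc out)
  | PProj i => ccopy (nth 0 args i) out fr
  | PComp f gs =>
    let k := size gs in
    CSeq ((fix go gs i := match gs with
           | [::] => CClear out
           | g :: gs => CSeq (compile g args i (fr + k)) (go gs i.+1) end) gs fr)
    (CSeq (compile f (iota fr k) out (fr + k))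
          (cseqs [seq CClear r | r <- iota fr k] (CClear fr)))
  | PPrim f g =>
    let: (acc, i, cnt, tmp) := (fr, fr.+1, fr.+2, fr.+3) in
    CSeq (compile f (behead args) acc fr.+4)
    (CSeq (ccopy (head 0 args) cnt tmp)
    (CSeq (CLoop cnt (CSeq (compile g (i :: acc :: behead args) tmp fr.+4)
            (CSeq (CClear acc) (CSeq (cmove tmp acc) (CInc i)))))
    (CSeq (cmove acc out) (CClear i))))
  | PMu f =>
    let: (m, tmp) := (fr, fr.+1) in
    CSeq (compile f (m :: args) tmp fr.+2)
    (CSeq (CLoop tmp (CSeq (CClear tmp) (CSeq (CInc m) (compile f (m :: args) tmp fr.+2))))
    (cmove m out))
  end.

Section PrfInd.
Variable P : prf -> Prop.
Hypotheses (Hz : P PZero) (Hs : P PSucc) (Hp : forall i, P (PProj i)).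
Hypothesis Hc : forall f gs, P f -> foldr (fun g => and (P g)) True gs -> P (PComp f gs).
Hypothesis Hr : forall f g, P f -> P g -> P (PPrim f g).
Hypothesis Hm : forall f, P f -> P (PMu f).
Fixpoint prf_nested_ind f : P f :=
  match f with
  | PZero => Hz | PSucc => Hs | PProj i => Hp i
  | PComp f gs => Hc (prf_nested_ind f)
      ((fix go gs : foldr (fun g => and (P g)) True gs := match gs with
        | [::] => I | g :: gs => conj (prf_nested_ind g) (go gs) end) gs)
  | PPrim f g => Hr (prf_nested_ind f) (prf_nested_ind g)
  | PMu f => Hm (prf_nested_ind f)
  end.
End PrfInd.

Definition frame args out fr (s : store) :=
  [/\ all (fun a => a < fr) args, out < fr, out \notin args, s out = 0
    & forall q, fr <= q -> s q = 0].

(** The final store differs from the initial one at [out] only, so scratch is clean again and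
    compiled pieces can be chained. *)
Definition compile_spec f := forall v z, prf_eval f v z -> forall args out fr s,
  frame args out fr s -> map s args = v -> exec (compile f args out fr) s (upd s out z).

(** A derivation unfolds from [k] down to 0, whereas the compiled loop counts up; the sequence [ys]
    of intermediate values lets one follow the loop. *)
Lemma prim_trace f g k v z : prf_eval (PPrim f g) (k :: v) z ->
  exists ys : nat -> nat, [/\ prf_eval f v (ys 0), ys k = z &
    forall j, j < k -> prf_eval g (j :: ys j :: v) (ys j.+1)].
Proof.
elim: k z => [|k IH] z H.
  by inversion H; subst; exists (fun _ => z); split.
have [y hy hz] : exists2 y, prf_eval (PPrim f g) (k :: v) y & prf_eval g (k :: y :: v) z.
  by inversion H; subst; exists y.
have [ys [h0 hk hj]] := IH _ hy.
exists (fun j => if j == k.+1 then z else ys j); split; rewrite ?eqxx //.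
move=> j; rewrite ltnS leq_eqVlt => /orP[/eqP->|ljk].
  by rewrite eqxx; case: eqP => [|_]; [lia|rewrite hk].
by rewrite eqSS; case: eqP => [|_]; [lia|case: eqP => [|_]; [lia|exact: hj]].
Qed.

Lemma map_upd s a z args : a \notin args -> map (upd s a z) args = map s args.
Proof. 
by move=> na; apply/eq_in_map => x xa; rewrite /upd; case: eqP => // e; rewrite -e xa in na.
Qed.

Lemma compile_correct f : compile_spec f.
Proof.
elim/prf_nested_ind: f => [||i|f gs IHf IHg|f g IHf IHg|f IHf] v z H args out fr s
    [hargs hout nout s0 sfr] hv.
- inversion H; subst; exact: ex_clear.
- have [x [w [ev ->]]] : exists x w, v = x :: w /\ z = x.+1.
    by inversion H; subst; exists x, v0.
  case: args hargs nout hv => [|a args] /=; first by rewrite ev.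
  move=> /andP[ha _]; rewrite inE negb_or ev => /andP[nout _] [<- _].
  apply: ex_seq (exec_copy _ _ _ _) _; rewrite ?(sfr fr) //; try lia.
  by apply: exec_eqr (ex_inc _ _) _; store_ext.
- have [hi ->] : i < size v /\ z = nth 0 v i by inversion H.
  rewrite -hv size_map in hi *; rewrite (nth_map 0) //.
  have hin := mem_nth 0 hi; have hlt : nth 0 args i < fr by apply: (allP hargs).
  have ne : nth 0 args i != out by apply/eqP => e; rewrite -e hin in nout.
  apply: exec_eqr (exec_copy _ _ _ _) _; rewrite ?(sfr fr) //; try lia.
  by store_ext.
- have [ys hys hz] : exists2 ys, prf_evals gs v ys & prf_eval f ys z.
    by inversion H; exists ys.
  subst v => /=; set k := size gs.
  pose fill (ys : seq nat) i (s : store) : store :=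
    fun q => if (i <= q) && (q < i + size ys) then nth 0 ys (q - i) else s q.
  have Hgo : forall gs ys i s', foldr (fun g => and (compile_spec g)) True gs ->
      prf_evals gs (map s args) ys -> fr <= i -> i + size gs = fr + k ->
      s' out = 0 -> (forall q, i <= q -> s' q = 0) -> map s' args = map s args ->
      size ys = size gs /\
      exec ((fix go gs i := match gs with
           | [::] => CClear out
           | g :: gs => CSeq (compile g args i (fr + k)) (go gs i.+1) end) gs i) s' (fill ys i s').
    elim=> [|g gs' IH] ys0 i s' /= hP He hi hik o0 z0 hm.
      have -> : ys0 = [::] by inversion He.
      split => //; apply: exec_eqr (ex_clear _ _) _ => q; rewrite /upd /fill /=.
      by case: eqP => [->|]; [rewrite o0|]; case: ifP => //; lia.
    have {He} [y [ys1 [-> hy hys1]]] : exists y ys1, [/\ ys0 = y :: ys1,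
        prf_eval g (map s args) y & prf_evals gs' (map s args) ys1].
      by inversion He; do 2 eexists; split; eauto.
    case: hP => hg hP.
    have nia : i \notin args by apply/negP => /(allP hargs); lia.
    have [|||||hsz1 E] := IH ys1 i.+1 (upd s' i y) hP hys1 _ _ _ _ _; try lia.
    + by rewrite /upd; case: eqP => //; lia.
    + by move=> q lq; rewrite /upd; case: eqP => [|_]; [lia|apply: z0; lia].
    + by rewrite map_upd.
    split; first by rewrite /= hsz1.
    apply: ex_seq (hg _ _ hy _ _ _ _ _ hm) _.
      split=> //; [|lia|by apply: z0|by move=> q ?; apply: z0; lia].
      by apply/allP => a /(allP hargs); lia.
    apply: exec_eqr E _ => q; rewrite /fill /upd /=.
    case: (ltngtP i q) => h /=; last 1 first.
    + by rewrite -h subnn /=; case: ifP => //; lia.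
    + by rewrite -addSnnS; case: ifP => // _; have -> : q - i = (q - i.+1).+1 by lia.
    + by [].
  have [|||||hsz E] := Hgo gs ys fr s IHg hys _ _ _ _ _ => //.
  apply: ex_seq E _; set s1 := fill _ _ _.
  have E1 : map s1 (iota fr k) = ys.
    apply: (@eq_from_nth _ 0); rewrite size_map size_iota // => i ik.
    by rewrite (nth_map 0) ?size_iota // nth_iota // /s1 /fill hsz addKn leq_addr ltn_add2l ik.
  apply: ex_seq (IHf _ _ hz _ _ _ _ _ E1) _.
    split.
    + by apply/allP => a; rewrite mem_iota => /andP[].
    + by lia.
    + by rewrite mem_iota; lia.
    + by rewrite /s1 /fill; case: ifP => //; lia.
    + by move=> q ?; rewrite /s1 /fill hsz; case: ifP => [|_]; [lia|apply: sfr; lia].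
  have Hcl : forall n i (s' : store), exec (cseqs [seq CClear r | r <- iota i n] (CClear fr)) s'
      (fun q => if (i <= q) && (q < i + n) || (q == fr) then 0 else s' q).
    elim=> [|n IH] i s' /=.
      by apply: exec_eqr (ex_clear _ _) _ => q; rewrite /upd; case: eqP; case: ifP => //; lia.
    apply: ex_seq (ex_clear _ _) _; apply: exec_eqr (IH _ _) _ => q; rewrite /upd.
    by do ! case: ifP; lia.
  apply: exec_eqr (Hcl _ _ _) _ => q; rewrite /upd /s1 /fill hsz -/k.
  by have := sfr q; do ! case: ifP; lia.
- case: args hargs nout hv => [|a args] /=; first by move=> _ _ e; subst; inversion H.
  move=> /andP[ha hargs]; rewrite inE negb_or => /andP[na nout] e; subst v.
  have [ys [h0 hk hj]] := prim_trace H.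
  have out_ne q : fr <= q -> (q \notin args) by move=> ?; apply/negP => /(allP hargs); lia.
  have hargs4 : all (fun a => a < fr.+4) args by apply/allP => x /(allP hargs); lia.
  apply: ex_seq (IHf _ _ h0 _ _ _ _ _ erefl) _.
    by split; [|lia|apply: out_ne|apply: sfr|move=> q ?; apply: sfr; lia].
  (* Loop invariant: the accumulator holds [ys j], the index register [j], and the counter the
     number [c] of stages to go. *)
  pose st j c := upd (upd (upd s fr (ys j)) fr.+1 j) fr.+2 c.
  apply: (@ex_seq _ _ _ (st 0 (s a))).
    apply: exec_eqr (exec_copy _ _ _ _) _; try lia.
      by rewrite /upd; case: eqP => [|_]; [lia|apply: sfr; lia].
    by move=> q; have := sfr q; have := sfr fr.+2 => z2 zq; rewrite /st /upd; do ! case: ifP; lia.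
  have Hst j c q : fr.+2 < q -> st j c q = 0.
    by move=> hq; rewrite /st /upd; do ! (case: eqP => [?|_]; first lia); apply: sfr; lia.
  have Hstm j c : map (st j c) args = map s args.
    by rewrite /st !map_upd //; apply: out_ne; lia.
  apply: (@ex_seq _ _ _ (st (s a) 0)).
    have loop : forall c j, j + c = s a -> exec (CLoop fr.+2
      (CSeq (compile g [:: fr.+1, fr & args] fr.+3 fr.+4)
         (CSeq (CClear fr) (CSeq (cmove fr.+3 fr) (CInc fr.+1))))) (st j c) (st (s a) 0).
      elim=> [|c IH] j hjc.
        by rewrite addn0 in hjc; subst j; apply: ex_loop0; rewrite /st /upd eqxx.
      have ej : upd (st j c.+1) fr.+2 c = st j c.
        by apply/funext => q; rewrite /st /upd; case: eqP.
      have lj : j < s a by lia.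
      apply: (@ex_loopS _ _ _ c); rewrite ?ej; first by rewrite /st /upd eqxx.
        apply: ex_seq (IHg _ _ (hj _ lj) _ _ _ _ _ _) _.
        + split=> /=; rewrite ?hargs4 ?Hst //; try lia.
            by rewrite !inE (negbTE (out_ne _ _)) //; lia.
          by move=> q ?; apply: Hst; lia.
        + rewrite /= Hstm; congr [:: _, _ & _].
            by rewrite /st /upd /= eqxx; case: eqP => //; lia.
          by rewrite /st /upd /= eqxx; do 2 (case: eqP => [?|_]; first lia).
        apply: ex_seq (ex_clear _ _) _; apply: ex_seq (exec_move _ _) _; first by lia.
        exact: ex_inc.
      set s' := upd _ _ _; suff -> : s' = st j.+1 c by apply: IH; lia.
      apply/funext => q; rewrite /s' /st /upd !eqxx.
      by have := sfr q; do ! case: ifP; lia.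
    exact: loop.
  apply: ex_seq (exec_move _ _) _; first by lia.
  apply: exec_eqr (ex_clear _ _) _ => q; rewrite /st /upd !eqxx -hk.
  by have := sfr q; do ! case: ifP; lia.
- have [hk hm] : prf_eval f (z :: v) 0 /\ (forall m, m < z -> exists j, prf_eval f (m :: v) j.+1).
    by inversion H.
  subst v.
  have out_ne q : fr <= q -> (q \notin args) by move=> ?; apply/negP => /(allP hargs); lia.
  pose st j c := upd (upd s fr j) fr.+1 c.
  have Ef j c : prf_eval f (j :: map s args) c ->
      exec (compile f (fr :: args) fr.+1 fr.+2) (st j 0) (st j c).
    move=> hf; apply: (exec_eqr (IHf _ _ hf _ _ _ _ _ _)).
    + split=> /=; try lia.
      * by rewrite (_ : fr < fr.+2) //=; apply/allP => x /(allP hargs); lia.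
      * by rewrite inE negb_or out_ne //; lia.
      * by rewrite /st /upd eqxx.
      * by move=> q ?; rewrite /st /upd; do ! (case: eqP => [?|_]; first lia); apply: sfr; lia.
    + rewrite /= /st !map_upd ?out_ne //; congr (_ :: _).
      by rewrite /upd eqxx; case: eqP => //; lia.
    + by move=> q; rewrite /st /upd; case: eqP.
  have e0 : s = st 0 0.
    apply/funext => q; rewrite /st /upd; case: eqP => [->|_]; first by rewrite sfr.
    by case: eqP => [->|//]; rewrite sfr.
  rewrite {1}e0 /=.
  (* [c0] is the value of [f] at 0; the loop only tests whether it vanishes. *)
  have [c0 hc0 [hz0 hz1]] : exists2 c0, prf_eval f (0 :: map s args) c0 &
      (z = 0 -> c0 = 0) /\ (z > 0 -> c0 > 0).
    case: (posnP z) => [z0|pz]; first by exists 0 => //; rewrite -{1}z0.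
    by have [j hj] := hm 0 pz; exists j.+1 => //; split=> //; lia.
  apply: ex_seq (Ef _ _ hc0) _.
  apply: (@ex_seq _ _ _ (st z 0)).
    have loop : forall d j c, j + d = z -> prf_eval f (j :: map s args) c ->
       (d = 0 -> c = 0) -> (d > 0 -> c > 0) ->
       exec (CLoop fr.+1 (CSeq (CClear fr.+1) (CSeq (CInc fr) (compile f (fr :: args) fr.+1 fr.+2))))
        (st j c) (st z 0).
      elim=> [|d IH] j c hjd hc h1 h2.
        by rewrite addn0 in hjd; subst j; rewrite h1 //; apply: ex_loop0; rewrite /st /upd eqxx.
      case: c h2 {h1} hc => [/(_ isT) //|c _ hc].
      have [c' hc' [h3 h4]] : exists2 c', prf_eval f (j.+1 :: map s args) c' &
           (d = 0 -> c' = 0) /\ (d > 0 -> c' > 0).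
        case: d hjd {IH} => [|d] hjd.
          by exists 0 => //; rewrite (_ : j.+1 = z) //; lia.
        by have [|j' hj'] := hm j.+1; [lia|exists j'.+1].
      apply: (@ex_loopS _ _ _ c); first by rewrite /st /upd eqxx.
        apply: ex_seq (ex_clear _ _) _; apply: ex_seq (ex_inc _ _) _.
        set s' := upd _ _ _; suff -> : s' = st j.+1 0 by apply: Ef hc'.
        apply/funext => q; rewrite /s' /st /upd.
        by have := sfr q; do ! case: ifP; lia.
      by apply: IH; rewrite // addSnnS.
    exact: (loop z 0).
  apply: exec_eqr (exec_move _ _) _; first by lia.
  move=> q; rewrite /st /upd eqxx.
  by have := sfr q; do ! case: ifP; lia.
Qed.

(** * From loop programs to modular rewriting of integers *)

(** Counter machine: [IInc r e] increments [r] and jumps to [e]; [IDec r e1 e0] decrements [r] and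
    jumps to [e1], or jumps to [e0] if [r] is zero. *)
Inductive instr : Type :=
| IInc : nat -> nat -> instr
| IDec : nat -> nat -> nat -> instr.

(* Code for [c] loaded at address [a] and jumping to address [e] when done. *)
Fixpoint asm (c : cmd) (a e : nat) : seq instr :=
  match c with
  | CInc r => [:: IInc r e]
  | CClear r => [:: IDec r a e]
  | CSeq c d => let l := asm c a (a + size (asm c a e)) in l ++ asm d (a + size l) e
  | CLoop r c => IDec r a.+1 e :: asm c a.+1 a
  end.

Fixpoint max_reg (c : cmd) : nat :=
  match c with
  | CInc r | CClear r => r
  | CSeq c d => maxn (max_reg c) (max_reg d)
  | CLoop r c => maxn r (max_reg c)
  end.

Lemma size_asm c a e a' e' : size (asm c a e) = size (asm c a' e').
Proof.
elim: c a e a' e' => //= [c IHc d IHd|r c IHc] a e a' e'; last by rewrite (IHc _ _ a'.+1 a').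
by rewrite !size_cat (IHc _ _ a' (a' + size (asm c a' e'))) (IHd _ _ (a' + size (asm c a' (a' + size (asm c a' e')))) e').
Qed.

Definition at_pos (P : seq instr) a l := forall i, i < size l -> onth P (a + i) = onth l i.

Lemma at_pos_cat P a l1 l2 : at_pos P a (l1 ++ l2) ->
  at_pos P a l1 /\ at_pos P (a + size l1) l2.
Proof.
move=> h; split=> i hi.
  by rewrite h ?size_cat ?(ltn_addr _ hi) // onth_cat hi.
by rewrite -addnA h ?size_cat ?ltn_add2l // onth_cat ifF ?addKn //; lia.
Qed.

(** One prime per register. [prime_above] gives some larger prime, so [base 1] stays symbolic. *)
Fixpoint base i := if i is j.+1 then s2val (prime_above (base j)) else 2.

Lemma base_prime i : prime (base i).
Proof. by case: i => // i /=; case: prime_above. Qed.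

Lemma base_gt1 i : 1 < base i. Proof. exact/prime_gt1/base_prime. Qed.

Lemma base_inj : injective base.
Proof.
have lt i j : i < j -> base i < base j.
  elim: j => // j IH; rewrite ltnS leq_eqVlt => /orP[/eqP->|/IH h] /=.
    by case: prime_above.
  by apply: ltn_trans h _; case: prime_above.
by move=> i j e; case: (ltngtP i j) => // /lt; rewrite e ltnn.
Qed.

(** * Numbers as configurations of a counter machine *)

Section Machine.
Variables (P : seq instr) (K R : nat).
Hypothesis sizeP : size P < K.

Definition regs (s : store) := \prod_(i < R) base i ^ s i.

Definition enc l s := K * regs s + l.

Definition nstep n : option nat :=
  match onth P (n %% K) with
  | Some (IInc r l) => Some (K * (base r * (n %/ K)) + l)
  | Some (IDec r l1 l0) =>
    if base r %| n %/ K then Some (K * (n %/ K %/ base r) + l1)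
    else Some (K * (n %/ K) + l0)
  | None => None
  end.

Inductive nsteps : nat -> nat -> Prop :=
| ns_refl n : nsteps n n
| ns_step n n1 n2 : nstep n = Some n1 -> nsteps n1 n2 -> nsteps n n2.

Lemma nsteps_trans n1 n2 n3 : nsteps n1 n2 -> nsteps n2 n3 -> nsteps n1 n3.
Proof. by move=> h; elim: h n3 => // {}n1 m {}n2 h _ IH n3 /IH; apply: ns_step. Qed.

Lemma nsteps1 n n1 : nstep n = Some n1 -> nsteps n n1.
Proof. by move=> h; apply: ns_step h (ns_refl _). Qed.

Lemma encK l s : l < K -> (enc l s %% K = l) * (enc l s %/ K = regs s).
Proof.
move=> lK; rewrite /enc mulnC modnMDl modn_small // divnMDl ?divn_small ?addn0 //.
exact: leq_ltn_trans lK.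
Qed.

Lemma regs_inc s r : r < R -> regs (upd s r (s r).+1) = base r * regs s.
Proof.
move=> rR; rewrite /regs (bigD1 (Ordinal rR)) //= [in RHS](bigD1 (Ordinal rR)) //= /upd eqxx expnS -!mulnA.
by congr (_ * (_ * _)); apply: eq_bigr => i ne; rewrite ifF //; apply/negbTE.
Qed.

Lemma regs_dvd s r : r < R -> (base r %| regs s) = (0 < s r).
Proof.
move=> rR; apply/idP/idP; last first.
  by move=> h; rewrite /regs (bigD1 (Ordinal rR)) //= dvdn_mulr // dvdn_exp.
rewrite /regs; elim/big_ind : _ => [|x y hx hy|i _].
- by rewrite dvdn1 => /eqP e; have := base_gt1 r; rewrite e.
- by rewrite Euclid_dvdM ?base_prime // => /orP[].
- rewrite Euclid_dvdX ?base_prime // dvdn_prime2 ?base_prime // => /andP[/eqP/base_inj ->].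
  by [].
Qed.

Lemma onthP_lt l i : onth P l = Some i -> l < K.
Proof. by move=> h; apply: ltn_trans sizeP; rewrite -onthTE h. Qed.

Lemma nstep_inc l r e s : r < R -> onth P l = Some (IInc r e) ->
  nstep (enc l s) = Some (enc e (upd s r (s r).+1)).
Proof. by move=> rR h; rewrite /nstep !(encK _ (onthP_lt h)) h /enc regs_inc. Qed.

Lemma nstep_dec0 l r e1 e s : r < R -> s r = 0 -> onth P l = Some (IDec r e1 e) ->
  nstep (enc l s) = Some (enc e s).
Proof. by move=> rR s0 h; rewrite /nstep !(encK _ (onthP_lt h)) h /enc regs_dvd ?s0. Qed.

Lemma nstep_decS l r e1 e s n : r < R -> s r = n.+1 -> onth P l = Some (IDec r e1 e) ->
  nstep (enc l s) = Some (enc e1 (upd s r n)).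
Proof.
move=> rR sn h; rewrite /nstep !(encK _ (onthP_lt h)) h /enc regs_dvd ?sn //=.
suff -> : regs s = base r * regs (upd s r n) by rewrite mulKn ?prime_gt0 ?base_prime.
rewrite -regs_inc //; congr regs; apply/funext => q; rewrite /upd eqxx.
by case: eqP => [->|].
Qed.

Lemma nsteps_clear l r e s : r < R -> onth P l = Some (IDec r l e) ->
  nsteps (enc l s) (enc e (upd s r 0)).
Proof.
move=> rR h; have [n hn] : exists n, s r = n by exists (s r).
elim: n s hn => [|n IH] s hn.
  apply: ns_step (nstep_dec0 rR hn h) _.
  suff -> : upd s r 0 = s by exact: ns_refl.
  by apply/funext => q; rewrite /upd; case: eqP => [->|].
apply: ns_step (nstep_decS rR hn h) _.
suff -> : upd s r 0 = upd (upd s r n) r 0 by apply: IH; rewrite /upd eqxx.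
by apply/funext => q; rewrite /upd; case: eqP.
Qed.

Lemma asm_correct c s s' : exec c s s' -> forall a e, at_pos P a (asm c a e) ->
  max_reg c < R -> nsteps (enc a s) (enc e s').
Proof.
elim=> {c s s'} [r s|r s|c d s1 s2 s3 _ IHc _ IHd|r c s s0|r c s n s1 s2 sn _ IHc _ IHl] a e /= h hR.
- by apply/nsteps1/nstep_inc => //; have := h 0 isT; rewrite addn0.
- by apply: nsteps_clear => //; have := h 0 isT; rewrite addn0.
- move/at_pos_cat: h => [h1 h2]; rewrite gtn_max in hR; have [hc hd] := andP hR.
  apply: nsteps_trans (IHd _ _ h2 hd).
  by apply: IHc => //; rewrite (size_asm c _ _ a e).
- rewrite gtn_max in hR; have [hr _] := andP hR.
  by apply/nsteps1/(@nstep_dec0 _ r a.+1) => //; have := h 0 isT; rewrite addn0.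
- have [hr hc] : r < R /\ max_reg c < R by rewrite gtn_max in hR; have [] := andP hR.
  have h0 : onth P a = Some (IDec r a.+1 e) by have := h 0 isT; rewrite addn0.
  apply: ns_step (nstep_decS hr sn h0) _; apply: nsteps_trans (IHl a e h hR).
  by apply: IHc => // i hi; have := h i.+1; rewrite addnS addSn; apply.
Qed.

Lemma nsteps_loop n m f : nsteps n m -> nstep m = Some m -> nstep f = None -> ~ nsteps n f.
Proof.
move=> h; elim: h f => {n m} [n|n n1 n2 h1 _ IH] f hm hf hs.
  have : nstep f = Some f; last by rewrite hf.
  by elim: hs hm => // {}n n1 n2 h1 _ IH; rewrite h1 => -[e]; apply: IH; rewrite e in h1 *.
by case: hs h1 hf => [k -> //|k k1 k2 -> hs [e] hf]; subst; apply: (IH k2).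
Qed.

(* [(m, r, (A, B))] stands for the partial map [m * v + r |-> A * v + B]. *)
Definition rule := (nat * nat * (nat * nat))%type.

(** A decrement splits by the residue [j] of the register product modulo [base r]: class 0 is
    divided by [base r], the other classes only change address. Each rule is thus affine on one
    residue class. *)
Definition rules_of l (i : instr) : seq rule :=
  match i with
  | IInc r e => [:: (K, l, (K * base r, e))]
  | IDec r e1 e0 => (K * base r, l, (K, e1)) ::
     [seq (K * base r, K * j + l, (K * base r, K * j + e0)) | j <- iota 1 (base r).-1]
  end.

Definition rules : seq rule :=
  flatten [seq (if onth P l is Some i then rules_of l i else [::]) | l <- iota 0 (size P)].

Definition instr_ok i := match i with IInc _ e => e < K | IDec _ e1 e0 => (e1 < K) && (e0 < K) end.

Inductive reach (rs : seq rule) : nat -> nat -> Prop :=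
| reach_refl n : reach rs n n
| reach_step m r A B v n : (m, r, (A, B)) \in rs -> reach rs (A * v + B) n ->
   reach rs (m * v + r) n.

Lemma mem_rules rho : rho \in rules ->
  exists l i, [/\ l < K, onth P l = Some i & rho \in rules_of l i].
Proof.
move/flattenP => [x /mapP[l]]; rewrite mem_iota => /andP[_ lP] ->.
case e : (onth P l) => [i|//] hr; exists l, i; split=> //; exact: ltn_trans sizeP.
Qed.

Lemma nstep_rule n n1 : nstep n = Some n1 ->
  exists m r A B v, [/\ (m, r, (A, B)) \in rules, n = m * v + r & n1 = A * v + B].
Proof.
rewrite /nstep; case e : (onth P (n %% K)) => [i|//].
have hl : n %% K < size P by rewrite -onthTE e.
have hin rho : rho \in rules_of (n %% K) i -> rho \in rules.
  move=> h; apply/flattenP; exists (rules_of (n %% K) i) => //.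
  by apply/mapP; exists (n %% K); rewrite ?mem_iota ?e.
case: i {e} hin => [r e|r e1 e0] hin.
  case=> <-; exists K, (n %% K), (K * base r), e, (n %/ K).
  by rewrite mulnA [K * (n %/ K)]mulnC -divn_eq; split=> //; apply: hin; rewrite inE eqxx.
have b0 : 0 < base r by rewrite prime_gt0 ?base_prime.
case: ifP => [dv|ndv] [<-].
  exists (K * base r), (n %% K), K, e1, (n %/ K %/ base r); split=> //.
    by apply: hin; rewrite inE eqxx.
  by rewrite -mulnA [base r * _]mulnC divnK // [K * _]mulnC -divn_eq.
pose j := (n %/ K) %% base r.
exists (K * base r), (K * j + n %% K), (K * base r), (K * j + e0), (n %/ K %/ base r).
have E : K * (n %/ K) = K * base r * (n %/ K %/ base r) + K * j.
  by rewrite -mulnA -mulnDr [base r * _]mulnC -divn_eq.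
split; last by rewrite E addnA.
  apply: hin; rewrite inE; apply/orP; right; apply/mapP; exists j => //.
  rewrite mem_iota; have : j < base r by rewrite ltn_mod.
  by move/negbT: ndv; rewrite /dvdn -/j; lia.
by rewrite addnA -E [K * _]mulnC -divn_eq.
Qed.

(** An applicable rule always performs the machine step, which makes rewriting deterministic. *)
Lemma rule_nstep m r A B v : (m, r, (A, B)) \in rules ->
  nstep (m * v + r) = Some (A * v + B).
Proof.
move=> /mem_rules [l [i [lK hl]]].
have E w : ((K * w + l) %% K = l) * ((K * w + l) %/ K = w).
  by rewrite mulnC modnMDl modn_small // divnMDl ?divn_small ?addn0 //; lia.
case: i hl => [q e|q e1 e0] hl; rewrite !inE.
  by case/eqP=> -> -> -> ->; rewrite /nstep !E hl mulnA.
case/orP => [/eqP[-> -> -> ->]|/mapP[j]].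
  by rewrite -mulnA /nstep !E hl dvdn_mulr // mulKn // prime_gt0 ?base_prime.
rewrite mem_iota => hj [-> -> -> ->].
rewrite addnA -mulnA -mulnDr /nstep !E hl dvdn_addr ?dvdn_mulr //.
rewrite gtnNdvd; [|lia|have := base_gt1 q; lia].
by rewrite mulnDr addnA.
Qed.

Lemma rules_wf m r A B : all instr_ok P -> (m, r, (A, B)) \in rules -> r < m /\ B < A.
Proof.
move=> hok /mem_rules [l [i [lK hl]]].
have : instr_ok i.
  have := hl; rewrite onthE; case: (ltnP l (size P)) => hs.
    by rewrite (nth_map i) // => -[<-]; apply: (all_nthP _ hok).
  by rewrite nth_default // size_map.
case: i hl => [q e|q e1 e0] hl /= hi; rewrite !inE; have b1 := base_gt1 q.
  by case/eqP=> -> -> -> ->; split=> //; nia.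
case/andP: hi => h1 h0; case/orP => [/eqP[-> -> -> ->]|/mapP[j]].
  by split=> //; nia.
by rewrite mem_iota => hj [-> -> -> ->]; split; nia.
Qed.

Lemma nsteps_reach n m : nsteps n m -> reach rules n m.
Proof.
elim=> [k|k k1 k2 h _ IH]; first exact: reach_refl.
have [m1 [r [A [B [v [hr -> e]]]]]] := nstep_rule h.
by apply: reach_step hr _; rewrite -e.
Qed.

Lemma reach_nsteps n m : reach rules n m -> nsteps n m.
Proof.
elim=> [k|m1 r A B v k hr _ IH]; first exact: ns_refl.
by apply: ns_step IH; apply: rule_nstep.
Qed.

End Machine.

Lemma instr_ok_asm K c a e : a + size (asm c a e) < K -> e < K -> all (instr_ok K) (asm c a e).
Proof.
elim: c a e => [r|r|c IHc d IHd|r c IHc] a e /=.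
- by rewrite andbT.
- by move=> h1 h2; rewrite h2 !andbT; lia.
- rewrite size_cat all_cat (size_asm c a _ a e) => h1 h2.
  by rewrite IHc ?IHd //; rewrite ?(size_asm c _ _ a e) //; lia.
- by move=> h1 h2; rewrite IHc ?h2 ?andbT; lia.
Qed.

(** The second clause holds because rewriting is deterministic and [h] has no successor. In the
    third, [n] encodes the registers [a], [b] at address 0. *)
Theorem modular_machine (g : prf) : exists (rs : seq rule) (K h : nat),
  [/\ forall m r A B, (m, r, (A, B)) \in rs -> r < m /\ B < A,
      forall m r A B v, (m, r, (A, B)) \in rs ->
        (reach rs (m * v + r) h <-> reach rs (A * v + B) h)
    & forall a b, let n := K * (2 ^ a * base 1 ^ b) in
      (prf_eval g [:: a; b] 1 -> reach rs n h) /\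
      (prf_eval g [:: a; b] 0 -> ~ reach rs n h)].
Proof.
pose c := compile g [:: 0; 1] 2 3; pose L := size (asm c 0 0).
(* The first added instruction loops forever on output 0. On output 1 it empties register 2, and the
   other two clear the inputs, so that the run ends in one fixed configuration. *)
pose P := asm c 0 L ++ [:: IDec 2 L.+1 L; IDec 0 L.+1 L.+2; IDec 1 L.+2 L.+3].
pose K := (size P).+1; pose R := (maxn (max_reg c) 2).+1.
have sP : size P = L + 3 by rewrite size_cat (size_asm c _ _ 0 0).
have hK : size P < K by [].
have Pc : at_pos P 0 (asm c 0 L).
  by move=> i hi; rewrite add0n /P onth_cat hi.
have Pe i : onth P (L + i) = onth [:: IDec 2 L.+1 L; IDec 0 L.+1 L.+2; IDec 1 L.+2 L.+3] i.
  by rewrite /P onth_cat (size_asm c _ _ 0 0) ifF ?addKn // -/L; lia.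
have P0 := Pe 0; have P1 := Pe 1; have P2 := Pe 2; have P3 := Pe 3.
rewrite addn0 in P0; rewrite addn1 in P1; rewrite addn2 in P2; rewrite addn3 in P3.
pose z : store := fun _ => 0; pose h := enc K R L.+3 z.
have R2 : 2 < R by rewrite /R ltnS leq_maxr.
have l3K : L.+3 < K by rewrite /K sP; lia.
have hN : nstep P K h = None by rewrite /nstep (@encK K R _ z l3K) P3.
exists (rules P K), K, h; split=> //.
- move=> m r A B; apply: rules_wf => //; rewrite all_cat /= instr_ok_asm //=.
  + by rewrite /K sP; lia.
  + by rewrite (size_asm c _ _ 0 0) /K sP -/L; lia.
  + by rewrite /K sP; lia.
- move=> m r A B v hr; split=> [|hs]; last exact: reach_step hr hs.
  have hst := rule_nstep hK v hr; move/(reach_nsteps hK) => hs; apply: nsteps_reach => //.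
  by case: hs hst hN => [k -> //|k k1 k2 -> hs [<-]].
move=> a b n; pose s : store := fun q => if q == 0 then a else if q == 1 then b else 0.
have En : n = enc K R 0 s.
  rewrite /n /enc addn0; congr (_ * _).
  have [q ->] : exists q, R = q.+3 by exists (R - 3); lia.
  by rewrite /regs !big_ord_recl /= big1 ?muln1 // => i _; rewrite expn0.
have run y : prf_eval g [:: a; b] y -> nsteps P K n (enc K R L (upd s 2 y)).
  move=> hy; rewrite En; apply: (@asm_correct _ _ _ _ c) => //.
    apply: compile_correct hy _ _ _ _ _ _ => //; split=> // q hq.
    by rewrite /s !ifF //; lia.
  by rewrite /R ltnS leq_maxl.
split=> hy.
  apply: (nsteps_reach hK); apply: nsteps_trans (run _ hy) _.
  apply: ns_step (@nstep_decS _ _ _ hK _ _ _ _ _ 0 R2 _ P0) _ => //.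
  apply: nsteps_trans (nsteps_clear hK _ _ P1) _; first by lia.
  apply: nsteps_trans (nsteps_clear hK _ _ P2) _; first by lia.
  rewrite /h; set s' := upd _ _ _; suff -> : s' = z by exact: ns_refl.
  by apply/funext => q; rewrite /s' /upd /s /z; do ! case: ifP.
move/(reach_nsteps hK); apply: nsteps_loop (run _ hy) _ hN.
by apply: (@nstep_dec0 _ _ _ hK _ 2 L.+1).
Qed.

(** * Words in a free group and ping-pong *)

Definition letter := (nat * bool)%type.
Definition word := seq letter.
Definition linv (l : letter) : letter := (l.1, ~~ l.2).
Definition winv (w : word) : word := rev (map linv w).

Lemma linvK : involutive linv. Proof. by case=> i b; rewrite /linv /= negbK. Qed.

Lemma winv_cons l w : winv (l :: w) = winv w ++ [:: linv l].
Proof. by rewrite /winv /= rev_cons cats1. Qed.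

Lemma winv_cat v w : winv (v ++ w) = winv w ++ winv v.
Proof. by rewrite /winv map_cat rev_cat. Qed.

Section Action.
Variables (T : Type) (act : letter -> T -> T).
Definition wact (w : word) (x : T) := foldr act x w.

Lemma wact_cons l w x : wact (l :: w) x = act l (wact w x). Proof. by []. Qed.

Lemma wact1 l x : wact [:: l] x = act l x. Proof. by []. Qed.

Lemma wact_cat v w x : wact (v ++ w) x = wact v (wact w x).
Proof. exact: foldr_cat. Qed.

Hypothesis actK : forall l x, act l (act (linv l) x) = x.

Lemma wactV w x : wact w (wact (winv w) x) = x.
Proof. by elim: w x => //= l w IH x; rewrite winv_cons wact_cat IH /= actK. Qed.

Lemma wactVK w x : wact (winv w) (wact w x) = x.
Proof.
elim: w x => //= l w IH x; rewrite winv_cons wact_cat /= -{2}(linvK l).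
by rewrite actK IH.
Qed.

Definition red_cons l (w : word) :=
  if w is l' :: w' then if l' == linv l then w' else l :: w else [:: l].
Definition reduce (w : word) := foldr red_cons [::] w.
Definition reduced (w : word) := sorted (fun l l' => l' != linv l) w.

(** Any action in which a letter and its inverse cancel factors through free reduction; this serves
    both the matrices and the permutation model. *)
Lemma wact_reduce w x : wact (reduce w) x = wact w x.
Proof.
elim: w => //= l w <-; rewrite /red_cons; case: (reduce w) => //= l' v.
by case: eqP => // -> /=; rewrite actK.
Qed.

End Action.

Lemma reduce_reduced w : reduced (reduce w).
Proof.
elim: w => //= l w; rewrite /reduced /red_cons; case: (reduce w) => //= l' v h.
by case: ifP => [_|/= ->] //; move: h; case: v => //= a v /andP[].
Qed.

Lemma reduce_all (p : pred letter) w : all p w -> all p (reduce w).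
Proof.
elim: w => //= l w IH /andP[pl /IH]; rewrite /red_cons; case: (reduce w) => /= [_|l' v].
  by rewrite pl.
by case/andP=> pl' pv; case: ifP => //= _; rewrite pl pl'.
Qed.

Local Open Scope ring_scope.

(** * Ping-pong in the rational plane *)

Notation point := (rat * rat)%type.

Definition dt (p : point) (v : 'cV[rat]_2) := p.1 * v 1 0 - p.2 * v 0 0.
Definition pdet (p q : point) := p.1 * q.2 - p.2 * q.1.
Definition nrm (v : 'cV[rat]_2) := `|v 0 0| + `|v 1 0|.
Definition pnrm (p : point) := `|p.1| + `|p.2|.

(* In the basis [p], [q] this is [diag(mu, 1)]. *)
Definition dilation (mu : rat) (p q : point) : 'M[rat]_2 := \matrix_(r, c)
  ((mu * (if r == 0 then p.1 else p.2) * (if c == 0 then q.2 else - q.1)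
    + (if r == 0 then q.1 else q.2) * (if c == 0 then - p.2 else p.1)) / pdet p q).

Lemma mx2P (A B : 'M[rat]_2) : A 0 0 = B 0 0 -> A 0 1 = B 0 1 ->
  A 1 0 = B 1 0 -> A 1 1 = B 1 1 -> A = B.
Proof.
move=> h1 h2 h3 h4; apply/matrixP => i j.
have two k : k = 0 \/ k = 1 :> 'I_2.
  by case: k => -[|[|//]] hk; [left|right]; apply/val_inj.
by case: (two i) => ->; case: (two j) => ->.
Qed.

Lemma dilationK mu p q : mu != 0 -> pdet p q != 0 ->
  dilation mu p q *m dilation mu^-1 p q = 1%:M.
Proof.
move=> h0 h1; have h2 : p.1 * q.2 - p.2 * q.1 != 0 by [].
by apply: mx2P; rewrite !mxE !big_ord_recl big_ord0 !mxE /= /pdet; field; rewrite h2 h0.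
Qed.

(** [dt p] sees only the coordinate along [q], which is fixed, and [dt q] only the one along [p],
    which is multiplied by [mu]. *)
Lemma dt_dilation mu p q v : pdet p q != 0 ->
  (dt p (dilation mu p q *m v) = dt p v) * (dt q (dilation mu p q *m v) = mu * dt q v).
Proof.
move=> h1; have h2 : p.1 * q.2 - p.2 * q.1 != 0 by [].
have e : lift ord0 (ord0 : 'I_1) = 1 :> 'I_2 by apply/val_inj.
by split; rewrite /dt !mxE !big_ord_recl !big_ord0 !mxE /= /pdet e; field; rewrite h2.
Qed.

Lemma dt_le p v : `|dt p v| <= pnrm p * nrm v.
Proof.
rewrite /dt /pnrm /nrm mulrDl !mulrDr -!normrM.
apply: le_trans (ler_normB _ _) _; have := normr_ge0 (p.1 * v 0 0).
by have := normr_ge0 (p.2 * v 1 0); lra.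
Qed.

Section PingPong.
Variables (q : nat).

(* Generator [i] dilates the direction [pt (2 * i)] and fixes [pt (2 * i + 1)]. *)
Definition pt (i : nat) : point := if i == 1%N then (0, 1) else (1, i.-1%:R).
Definition bound : rat := (2 * q + 1)%:R.
(* [2 * bound ^+ 2 * (2 * bound ^+ 2) < lam] is what [near_step] needs. *)
Definition lam : rat := (4 * (2 * q + 1) ^ 4 + 1)%:R.

Lemma lamE : lam = 4 * bound ^+ 4 + 1.
Proof. by rewrite /lam /bound natrD natrM natrX. Qed.

Lemma bound_ge1 : 1 <= bound.
Proof. by rewrite /bound ler1n; lia. Qed.

Lemma lam_gt0 : 0 < lam. Proof. by rewrite ltr0n; lia. Qed.

(** The ping-pong cone about the direction [pt i]. *)
Definition near i v := 2 * bound * `|dt (pt i) v| < nrm v.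

Lemma pnrm_pt i : (i < 2 * q)%N -> 0 < pnrm (pt i) <= bound.
Proof.
rewrite /pnrm /pt /bound; case: eqP => _ h /=.
  by rewrite normr0 normr1 add0r ?ltr01 ?ler1n; lia.
rewrite normr1 normr_nat -[1]/(1%:R) -natrD ltr0n ler_nat; lia.
Qed.

Lemma pdet_pt i j : i != j -> 1 <= `|pdet (pt i) (pt j)|.
Proof.
rewrite /pdet /pt; case: (i =P 1%N) => [ei|hi]; case: (j =P 1%N) => [ej|hj] /= hij.
- by rewrite ei ej eqxx in hij.
- by rewrite mul0r sub0r mulr1 normrN normr1.
- by rewrite mul1r mulr0 subr0 normr1.
- rewrite mul1r mulr1 -[i.-1%:R]/((i.-1 : int)%:~R) -[j.-1%:R]/((j.-1 : int)%:~R).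
  by rewrite -intrB -intr_norm (ler_int _ 1); lia.
Qed.

(** By Cramer's rule the coordinates of [v] are combinations of the two [dt] values divided by a
    determinant of absolute value at least 1, so both values cannot be small compared with
    [nrm v]. *)
Lemma near_disjoint i j v : (i < 2 * q)%N -> (j < 2 * q)%N -> i != j ->
  near i v -> near j v -> False.
Proof.
move=> hi hj ij; rewrite /near.
have := pdet_pt ij; set d := `|pdet _ _| => hd.
have /andP[ni0 ni] := pnrm_pt hi; have /andP[nj0 nj] := pnrm_pt hj.
have b1 := bound_ge1.
set a := `|dt (pt i) v|; set b := `|dt (pt j) v| => ha hb.
have a0 : 0 <= a := normr_ge0 _; have b0 : 0 <= b := normr_ge0 _.
have e0 : d * `|v 0 0| <= `|(pt j).1| * a + `|(pt i).1| * b.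
  rewrite -!normrM (_ : _ * v 0 0 = (pt j).1 * dt (pt i) v - (pt i).1 * dt (pt j) v).
    exact: ler_normB.
  by rewrite /pdet /dt; ring.
have e1 : d * `|v 1 0| <= `|(pt j).2| * a + `|(pt i).2| * b.
  rewrite -!normrM (_ : _ * v 1 0 = (pt j).2 * dt (pt i) v - (pt i).2 * dt (pt j) v).
    exact: ler_normB.
  by rewrite /pdet /dt; ring.
have hn : nrm v <= d * nrm v by rewrite ler_peMl // /nrm addr_ge0.
have : d * nrm v <= bound * a + bound * b.
  apply: (@le_trans _ _ (pnrm (pt j) * a + pnrm (pt i) * b)); last first.
    by apply: lerD; apply: ler_wpM2r.
  by rewrite /nrm /pnrm; move: e0 e1; lra.
by lra.
Qed.

(** Outside the cone of [pt j], the value [dt (pt j) v] is comparable to [nrm v]; magnified by [lam]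
    it forces [w] to be long, while [dt (pt i)] grew only by [c]. The factor [c] is 1 for a
    generator and [lam^-1] for its inverse. *)
Lemma near_step i j v w c : (i < 2 * q)%N -> (j < 2 * q)%N -> 0 < c -> 0 < nrm v ->
  `|dt (pt i) w| = c * `|dt (pt i) v| -> `|dt (pt j) w| = c * lam * `|dt (pt j) v| ->
  ~ near j v -> near i w.
Proof.
move=> hi hj c0 v0 ei ej /negP; rewrite /near -leNgt => hv.
have /andP[ni0 ni] := pnrm_pt hi; have /andP[nj0 nj] := pnrm_pt hj.
have b1 := bound_ge1; have l0 := lam_gt0.
have lei := dt_le (pt i) v; have lej := dt_le (pt j) w.
have w0 : 0 <= nrm w by rewrite addr_ge0.
rewrite ei in lei *; rewrite ej in lej.
set B := bound in b1 ni nj hv *.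
have h1 : lam * (c * nrm v) <= 2 * B ^+ 2 * nrm w.
  apply: (@le_trans _ _ (lam * c * (2 * B * `|dt (pt j) v|))).
    by rewrite [leLHS]mulrA ler_pM2l ?mulr_gt0.
  rewrite (_ : _ * _ = 2 * B * (c * lam * `|dt (pt j) v|)); last by ring.
  rewrite expr2 (_ : 2 * (B * B) * nrm w = 2 * B * (B * nrm w)); last by ring.
  rewrite ler_pM2l; last by lra.
  by apply: le_trans lej _; apply: ler_wpM2r.
have h2 : `|dt (pt i) v| <= B * nrm v by apply: le_trans lei _; apply: ler_wpM2r => //; lra.
have h3 : 2 * B * (c * `|dt (pt i) v|) <= 2 * B ^+ 2 * (c * nrm v).
  rewrite (_ : 2 * B * _ = 2 * B * c * `|dt (pt i) v|); last by ring.
  rewrite (_ : 2 * B ^+ 2 * _ = 2 * B * c * (B * nrm v)); last by ring.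
  by rewrite ler_pM2l // !mulr_gt0 //; lra.
have B2 : 0 < 2 * B ^+ 2 by rewrite mulr_gt0 ?exprn_gt0 //; lra.
rewrite -(ltr_pM2l B2); apply: (lt_le_trans _ h1).
apply: (@le_lt_trans _ _ (2 * B ^+ 2 * (2 * B ^+ 2 * (c * nrm v)))).
  by rewrite ler_pM2l.
rewrite mulrA ltr_pM2r ?mulr_gt0 // lamE -/B.
by rewrite (_ : 2 * B ^+ 2 * (2 * B ^+ 2) = 4 * B ^+ 4); [lra|ring].
Qed.

(** Index of the attracting direction of [l]; the repelling one is [attr (linv l)]. *)
Definition attr (l : letter) := (2 * l.1 + ~~ l.2)%N.

Definition rho1 (l : letter) : 'M[rat]_2 :=
  dilation (if l.2 then lam else lam^-1) (pt (2 * l.1)) (pt (2 * l.1).+1).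

Lemma pdet_neq0 i j : i != j -> pdet (pt i) (pt j) != 0.
Proof. by move=> /pdet_pt h; rewrite -normr_gt0; apply: lt_le_trans h. Qed.

Lemma rho1K l : rho1 l *m rho1 (linv l) = 1%:M.
Proof.
have l0 := lam_gt0; have hd : pdet (pt (2 * l.1)) (pt (2 * l.1).+1) != 0.
  by apply: pdet_neq0; lia.
rewrite /rho1; case: l hd => i [] /= hd.
  by apply: dilationK => //; lra.
by rewrite -{2}[lam]invrK; apply: dilationK => //; rewrite invr_neq0 //; lra.
Qed.

Definition act1 m (l : letter) (M : 'M[rat]_(2, m)) := rho1 l *m M.
Definition rho (w : word) : 'M[rat]_2 := wact (@act1 2) w 1%:M.
Arguments rho w : simpl never.

Lemma rho_cons l w : rho (l :: w) = rho1 l *m rho w. Proof. by []. Qed.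

Lemma act1K m l (M : 'M[rat]_(2, m)) : act1 l (act1 (linv l) M) = M.
Proof. by rewrite /act1 mulmxA rho1K mul1mx. Qed.

Lemma rhoE m w (M : 'M[rat]_(2, m)) : rho w *m M = wact (@act1 m) w M.
Proof.
by rewrite /rho; elim: w => [|l w IH] /=; rewrite ?mul1mx // /act1 -mulmxA IH.
Qed.

Lemma rho_cat v w : rho (v ++ w) = rho v *m rho w.
Proof. by rewrite rhoE -wact_cat. Qed.

Lemma rhoV w : rho w *m rho (winv w) = 1%:M.
Proof. by rewrite rhoE /rho wactV //; exact: act1K. Qed.

Lemma rho_reduce w : rho (reduce w) = rho w.
Proof. exact: (wact_reduce (@act1K 2)). Qed.

Lemma nrm_gt0 v : v != 0 -> 0 < nrm v.
Proof.
move=> v0; rewrite lt_neqAle addr_ge0 ?normr_ge0 // andbT eq_sym.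
apply: contra v0; rewrite paddr_eq0 ?normr_ge0 // !normr_eq0 => /andP[/eqP a /eqP b].
apply/eqP/matrixP => i j; rewrite mxE (ord1 j).
by case: i => -[|[|//]] hi; [rewrite -[RHS]a|rewrite -[RHS]b]; congr (v _ _); apply/val_inj.
Qed.

Lemma near_rho1 l v : (l.1 < q)%N -> v != 0 -> ~ near (attr (linv l)) v ->
  near (attr l) (rho1 l *m v).
Proof.
move=> hl v0; have l0 := lam_gt0.
have hd : pdet (pt (2 * l.1)) (pt (2 * l.1).+1) != 0 by apply: pdet_neq0; lia.
rewrite /rho1; case: l hl hd => i [] /= hl hd.
  apply: (@near_step _ _ _ _ 1); rewrite ?ltr01 ?nrm_gt0 /attr /= ?addn0 ?addn1; try lia.
    by rewrite dt_dilation // mul1r.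
  by rewrite dt_dilation // mul1r normrM gtr0_norm.
apply: (@near_step _ _ _ _ lam^-1); rewrite ?invr_gt0 ?nrm_gt0 /attr /= ?addn0 ?addn1; try lia.
- by [].
- by rewrite dt_dilation // normrM gtr0_norm // invr_gt0.
- by rewrite dt_dilation // mulVf ?mul1r //; lra.
Qed.

(* This is [pt 3], the direction fixed by generator 1. *)
Definition uvec : 'cV[rat]_2 := \col_i (if i == 0 then 1 else 2).

Lemma rho_uvec b : rho1 (1%N, b) *m uvec = uvec.
Proof.
apply/matrixP => i j; rewrite (ord1 j) !mxE !big_ord_recl big_ord0 !mxE /=.
by case: (i == 0); rewrite /pdet /pt /=; field; rewrite ?mulr0 ?subr0 //; lra.
Qed.

Lemma rho_neq0 w (v : 'cV[rat]_2) : v != 0 -> rho w *m v != 0.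
Proof.
apply: contra => /eqP h; have := wactVK (@act1K 1) w v.
rewrite -!rhoE h mulmx0 => <-; exact: eqxx.
Qed.

Lemma near_uvec : near 3 uvec.
Proof.
by rewrite /near /dt /nrm /pt /uvec !mxE /= mul1r mulr1 subrr normr0 mulr0 addr_gt0.
Qed.

Lemma uvec_neq0 : uvec != 0.
Proof. by apply/eqP => /matrixP /(_ 0 0); rewrite !mxE. Qed.

(** The innermost letter, not belonging to generator 1, finds [uvec] outside its repelling cone;
    reducedness gives the same for each further letter. So the outermost letter decides the cone. *)
Lemma near_rho l w : reduced (l :: w) -> all (fun l => (l.1 < q)%N) (l :: w) -> (1 < q)%N ->
  (last l w).1 != 1%N -> near (attr l) (rho (l :: w) *m uvec).
Proof.
elim: w l => [|l' w IH] l.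
  move=> _ /= /andP[hl _] q1 ne; rewrite rho_cons mulmx1; apply: near_rho1 => //.
    exact: uvec_neq0.
  move=> h; apply: (near_disjoint _ _ _ h near_uvec); rewrite /attr /=; try lia.
move=> /= /andP[hl hr] /andP[lq hq] q1 ne.
have {IH} h := IH l' hr hq q1 ne.
rewrite rho_cons -mulmxA; apply: near_rho1 => //.
  by apply/rho_neq0/uvec_neq0.
have l'q : (l'.1 < q)%N by case/andP: hq.
move=> h2; apply: (near_disjoint _ _ _ h2 h); rewrite /attr /=; try (case: (l.2); case: (l'.2); lia).
move: hl; rewrite /linv; case: l {ne h2} lq => i b /= lq; case: l' {h hr hq} l'q => i' b' /= l'q.
by rewrite xpair_eqE; case: b; case: b'; lia.
Qed.

(** Trailing letters of generator 1 fix [uvec] and are stripped. If another letter then remains at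
    the end, [near_rho] puts the image of [uvec] in a cone different from its own. *)
Lemma stab_uvec w : reduced w -> all (fun l => (l.1 < q)%N) w -> (1 < q)%N ->
  rho w *m uvec = uvec -> all (fun l => l.1 == 1%N) w.
Proof.
move=> hr ha q1.
have [n hn] := ubnP (size w); elim: n w hn hr ha => // n IH w hn hr ha hw.
case/lastP: w hn hr ha hw => // w l; rewrite size_rcons => hn hr ha hw.
case: (eqVneq l.1 1%N) => [l1|ne].
  rewrite all_rcons l1 eqxx /=.
  rewrite all_rcons in ha; case/andP: ha => _ ha.
  apply: IH => //; first by move: hr; case: w {hn ha hw} => //= a w; rewrite rcons_path => /andP[].
  rewrite -cats1 rho_cat -mulmxA rho_cons mulmx1 in hw.
  by case: l l1 hw {hn hr} => i b /= ->; rewrite rho_uvec.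
exfalso; move: (rcons w l) (last_rcons (1%N, true) w l) hr ha hw {hn IH}.
elim=> [|a v IH] /= hl hr ha hw; first by rewrite -hl in ne.
have {hl} hl : last a v = l by [].
have h : near (attr a) (rho (a :: v) *m uvec) by apply: near_rho => //; rewrite hl.
rewrite hw in h; case/andP: (ha) => aq hav.
(* A leading letter of generator 1 may attract to the very cone of [uvec]; it is moved to the other
   side, where it fixes [uvec]. *)
case: (eqVneq a.1 1%N) => [a1|na].
  case: v hl hr hav IH {ha h} hw => [|b v] hl hr hav IH hw; first by rewrite -hl /= a1 in ne.
  apply: IH => //; first by case/andP: hr.
  have h2 : rho1 (linv a) *m uvec = uvec by rewrite /linv a1 rho_uvec.
  have h3 : rho1 (linv a) *m rho1 a = 1%:M by rewrite -{2}(linvK a) rho1K.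
  by rewrite -[RHS]h2 -[in RHS]hw (rho_cons a) [RHS]mulmxA [in RHS](mulmxA _ (rho1 a)) h3 mul1mx.
apply: (near_disjoint _ _ _ h near_uvec); rewrite /attr; try lia.
Qed.

End PingPong.

Arguments rho q w : simpl never.

Local Close Scope ring_scope.

(** * A permutation model of the presented group *)

Lemma bij_of_inj_surj (X Y : Type) (f : X -> Y) :
  injective f -> (forall y, exists x, f x = y) -> bijective f.
Proof.
move=> fi fs; pose g y := sval (cid (fs y)).
have gK y : f (g y) = y by rewrite /g; case: cid.
by exists g => // x; apply: fi.
Qed.

(** The last clause says that [h] agrees pointwise with [f] or with the inverse of [g], so whatever
    both injections preserve is preserved by [h]. *)
Lemma schroeder_bernstein (X Y : Type) (f : X -> Y) (g : Y -> X) :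
  injective f -> injective g ->
  exists2 h : X -> Y, bijective h & forall x, h x = f x \/ x = g (h x).
Proof.
move=> fi gi; pose C x := exists n x0, (forall y, x0 <> g y) /\ x = iter n (g \o f) x0.
have hC x : ~ C x -> exists y, g y = x.
  move=> nC; apply: contrapT => hx; apply: nC; exists 0, x; split=> // y e.
  by apply: hx; exists y.
pose h x := if pselect (C x) is right nC then sval (cid (hC x nC)) else f x.
have hP x : (C x /\ h x = f x) \/ (~ C x /\ g (h x) = x).
  by rewrite /h; case: pselect => c; [left|right; case: cid].
have CS x : C x -> C (g (f x)) by move=> [n [x0 [h0 ->]]]; exists n.+1, x0.
exists h; last by move=> x; case: (hP x) => -[_]; [left|right].
apply: bij_of_inj_surj => [x x'|y].
  case: (hP x) => -[c e]; case: (hP x') => -[c' e'].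
  - by rewrite e e' => /fi.
  - by rewrite e => ee; case: c'; rewrite -e' -ee; apply: CS.
  - by rewrite e' => ee; case: c; rewrite -e ee; apply: CS.
  - by move=> ee; rewrite -e -e' ee.
have [[n [x0 [h0 e]]]|nc] := pselect (C (g y)); last first.
  by exists (g y); case: (hP (g y)) => -[c] // /gi.
case: n e => [/= e|n /= /gi ->]; first by case: (h0 y).
exists (iter n (g \o f) x0); case: (hP (iter n (g \o f) x0)) => -[c] //.
by case: c; exists n, x0.
Qed.

Lemma if_true (P : Prop) T (a b : T) : P -> (if pselect P then a else b) = a.
Proof. by case: pselect. Qed.

Lemma if_false (P : Prop) T (a b : T) : ~ P -> (if pselect P then a else b) = b.
Proof. by case: pselect. Qed.

Definition transp (T : Type) (a b x : T) : T :=
  if pselect (x = a) then b else if pselect (x = b) then a else x.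

Lemma transpK (T : Type) (a b : T) : involutive (transp a b).
Proof. by move=> x; rewrite /transp; do ! (case: pselect => ? //); congruence. Qed.

(** * Coloured sites and the action of the generators *)

Section Model.
Variables (rs : seq rule) (h : nat).
Hypothesis rs_wf : forall m r A B, (m, r, (A, B)) \in rs -> r < m /\ B < A.
Hypothesis rs_closed : forall m r A B v, (m, r, (A, B)) \in rs ->
  (reach rs (m * v + r) h <-> reach rs (A * v + B) h).

Local Open Scope ring_scope.

(* The second component only serves to make the fibres of [pattern] equinumerous. *)
Definition sheet := ((int -> Prop) * seq (nat * (int -> Prop)))%type.
Definition site := (int * sheet)%type.
Definition colour (s : site) : Prop := s.2.1 s.1.

Definition halting (n : int) : Prop := if n is Posz k then reach rs k h else False.
Definition i0 : sheet := (halting, [::]).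

(** The colouring that the sheet induces on one residue class modulo [m], reindexed by all
    integers. *)
Definition pattern m (x : 'I_m * sheet) (u : int) : Prop := x.2.1 (u *+ m + x.1%:Z).

(** Moves the pattern to class 0 modulo [A] of a new sheet; the old class and colouring are pushed
    on the tag list, which makes the map injective. *)
Definition repack m A (A0 : (0 < A)%N) (x : 'I_m * sheet) : 'I_A * sheet :=
  (Ordinal A0, (fun n => pattern x (n %/ A)%Z, (val x.1, x.2.1) :: x.2.2)).

Lemma mulrn_int (u : int) (n : nat) : u *+ n = u * n%:Z.
Proof. by rewrite -mulr_natr natz. Qed.

Lemma divzE (A : nat) (c : 'I_A) (u : int) :
  (((u *+ A + c%:Z) %/ A)%Z = u) * (((u *+ A + c%:Z) %% A)%Z = c).
Proof.
have A0 : (A%:Z != 0) by case: A c => [[]|].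
rewrite mulrn_int divzMDl // modzMDl.
rewrite divz_small ?modz_small ?addr0 //; have := ltn_ord c; lia.
Qed.

Lemma pattern_repack m A A0 (x : 'I_m * sheet) : pattern (@repack m A A0 x) = pattern x.
Proof. by apply/funext => u; rewrite {1}/pattern /repack /= (divzE (Ordinal A0)). Qed.

Lemma repack_inj m A A0 : injective (@repack m A A0).
Proof. by move=> [c [S y]] [c' [S' y']] [_ /val_inj -> -> ->]. Qed.

(** Repacking in both directions yields a pattern-preserving bijection; a transposition of two
    points with equal patterns then makes it send [x] to [y]. *)
Lemma pattern_bij m A (x : 'I_m * sheet) (y : 'I_A * sheet) : pattern x = pattern y ->
  exists f : 'I_m * sheet -> 'I_A * sheet,
    [/\ bijective f, f x = y & forall z, pattern (f z) = pattern z].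
Proof.
move=> exy; have m0 : (0 < m)%N by apply: leq_ltn_trans (ltn_ord x.1).
have A0 : (0 < A)%N by apply: leq_ltn_trans (ltn_ord y.1).
have [f fb fP] := schroeder_bernstein (@repack_inj m A A0) (@repack_inj A m m0).
have fpat z : pattern (f z) = pattern z.
  by case: (fP z) => [->|{2}->]; rewrite pattern_repack.
exists (transp (f x) y \o f); split=> [||z] /=.
- by apply: bij_comp fb; apply: inv_bij; apply: transpK.
- by rewrite /transp; case: pselect.
- rewrite -(fpat z) /transp; case: pselect => [e|_] /=; first by rewrite e fpat exy.
  by case: pselect => [e|//] /=; rewrite e fpat exy.
Qed.

(** Keeping the quotient while changing the class turns translation by [m.+1] into translation by
    [A]. *)
Definition lift_bij m A (f : 'I_m.+1 * sheet -> 'I_A * sheet) (s : site) : site :=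
  let y := f (inord `|(s.1 %% m.+1)%Z|%N, s.2) in ((s.1 %/ m.+1)%Z *+ A + y.1%:Z, y.2).

Lemma lift_bijE m A f u (c : 'I_m.+1) i :
  @lift_bij m A f (u *+ m.+1 + c%:Z, i) = (u *+ A + (f (c, i)).1%:Z, (f (c, i)).2).
Proof. by rewrite /lift_bij /= !divzE /= inord_val. Qed.

Lemma siteP m (n : int) : exists (u : int) (c : 'I_m.+1), n = u *+ m.+1 + c%:Z.
Proof.
exists (n %/ m.+1)%Z, (inord `|(n %% m.+1)%Z|%N); rewrite inordK; last first.
  by have := ltz_pmod n (isT : 0 < m.+1%:Z); have := modz_ge0 n (isT : m.+1%:Z != 0); lia.
rewrite gez0_abs ?modz_ge0 // -mulr_natr natz; exact: divz_eq.
Qed.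

Lemma kappa_ex m r A B : (m, r, (A, B)) \in rs -> exists k : (site -> site) * (site -> site),
  [/\ cancel k.1 k.2, cancel k.2 k.1, k.1 (r%:Z, i0) = (B%:Z, i0),
      forall n i, k.1 (n - m%:Z, i) = ((k.1 (n, i)).1 - A%:Z, (k.1 (n, i)).2)
    & forall s, colour (k.1 s) = colour s].
Proof.
move=> hr; have [rm BA] := rs_wf hr; have cl v := rs_closed v hr.
case: m A hr rm BA cl => // m [//|A] hr rm BA cl.
(* For nonnegative quotients the colours agree because a rule does not change whether [h] is
   reached; for negative ones both positions are negative, as [r < m] and [B < A], hence
   uncoloured. *)
have hp : pattern (Ordinal rm, i0) = pattern (Ordinal BA, i0).
  apply/funext => -[v|v]; rewrite /pattern /=.
    have E (M R : nat) : Posz v *+ M + R%:Z = (M * v + R)%N.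
      by rewrite mulrn_int PoszD PoszM mulrC.
    by rewrite !E; apply/propext; exact: cl.
  have E (M R : nat) : (R <= M)%N -> halting (Negz v *+ M.+1 + R) = False.
    move=> RM; have : Negz v *+ M.+1 + R < 0 by rewrite mulrn_int NegzE; nia.
    by case: (_ + _).
  by rewrite !E.
have [f [[g fK gK] fx fpat]] := pattern_bij hp.
move: (lift_bij f) (lift_bij g) (lift_bijE f) (lift_bijE g) => F G FE GE.
exists (F, G); split=> /=.
- by move=> [n i]; have [u [c ->]] := siteP m n; rewrite FE GE -surjective_pairing fK.
- by move=> [n i]; have [u [c ->]] := siteP A n; rewrite GE FE -surjective_pairing gK.
- by have := FE 0 (Ordinal rm) i0; rewrite !mul0rn !add0r fx.
- move=> n i; have [u [c ->]] := siteP m n.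
  have -> : u *+ m.+1 + c%:Z - m.+1%:Z = (u - 1) *+ m.+1 + c%:Z.
    by rewrite !mulrn_int; ring.
  by rewrite !FE /= !mulrn_int; congr (_, _); ring.
- move=> [n i]; have [u [c ->]] := siteP m n; rewrite FE.
  by have := congr1 (fun p => p u) (fpat (c, i)).
Qed.

Definition kappa (j : nat) (b : bool) : site -> site :=
  match pselect (nth (0, 0, (0, 0))%N rs j \in rs) with
  | left hj =>
    match nth (0, 0, (0, 0))%N rs j as p return p \in rs -> _ with
    | (m, r, (A, B)) => fun hj => let k := sval (cid (kappa_ex hj)) in if b then k.1 else k.2
    end hj
  | right _ => id
  end.

Lemma kappaK j b : cancel (kappa j (~~ b)) (kappa j b).
Proof.
rewrite /kappa; case: pselect => // hj; move: hj; case: (nth _ _ _) => [[m r] [A B]] hj.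
by case: cid => k []; case: b.
Qed.

Lemma kappaP j m r A B : (j < size rs)%N -> nth (0, 0, (0, 0))%N rs j = (m, r, (A, B)) ->
  [/\ kappa j true (r%:Z, i0) = (B%:Z, i0),
      forall n i, kappa j true (n - m%:Z, i)
         = ((kappa j true (n, i)).1 - A%:Z, (kappa j true (n, i)).2)
    & forall s, colour (kappa j true s) = colour s].
Proof.
move=> js; have := mem_nth (0, 0, (0, 0))%N js; rewrite /kappa.
case: pselect => // hj _; move: hj; case: (nth _ _ _) => [[m' r'] [A' B']] hj [? ? ? ?]; subst.
by case: cid => k [].
Qed.

(** Above each site lies a copy of the integers. [u] translates it unless the site is coloured, and
    [t] reflects it above [(0, i0)]; a reflection and a translation do not commute. *)
Definition state := (site * int)%type.

(* Letter 0 is the translation [x], letter 1 is [u], letter 2 is [t] and letter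
   [j + 3] is the stable letter [k_j] of the [j]-th rule. *)
Definition mact (l : letter) (p : state) : state :=
  let: ((n, i), z) := p in
  match l.1 with
  | 0 => ((if l.2 then n - 1 else n + 1, i), z)
  | 1 => ((n, i), if pselect (colour (n, i)) then z else if l.2 then z + 1 else z - 1)
  | 2 => ((n, i), if pselect ((n, i) = (0, i0)) then - z else z)
  | j.+3 => (kappa j l.2 (n, i), z)
  end.

Lemma mactK l p : mact l (mact (linv l) p) = p.
Proof.
case: l => -[|[|[|j]]] b; case: p => -[n i] z; rewrite /mact /=.
- by case: b => /=; rewrite ?addrK ?subrK.
- by case: pselect => //= c; case: b => /=; rewrite ?addrK ?subrK.
- by case: pselect => //= _; rewrite opprK.
- by case e : (kappa j (~~ b) (n, i)) => [n' i']; rewrite -e kappaK.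
Qed.

Definition x_ (n : nat) : word := nseq n (0%N, true).
Definition u_ : letter := (1%N, true).
Definition t_ : letter := (2%N, true).
Definition k_ j : letter := (j.+3, true).
(* In the model [tw n] acts only above the site [(n, i0)]. *)
Definition tw n : word := winv (x_ n) ++ t_ :: x_ n.

Definition rule_rels (j : nat) (rho : rule) : seq (word * word) :=
  let: (m, r, (A, B)) := rho in
  [:: (k_ j :: x_ m, x_ A ++ [:: k_ j]); (k_ j :: tw r, tw B ++ [:: k_ j]);
      ([:: u_; k_ j], [:: k_ j; u_])].

Definition relations : seq (word * word) := (u_ :: tw h, tw h ++ [:: u_]) ::
  flatten [seq rule_rels j (nth (0, 0, (0, 0))%N rs j) | j <- iota 0 (size rs)].

Lemma mact_x n m i z : wact mact (x_ n) ((m, i), z) = ((m - n%:Z, i), z).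
Proof.
elim: n => [|n IH] /=; first by rewrite subr0.
by rewrite IH /mact /=; congr (_, _, _); rewrite -[n.+1]addn1 PoszD; ring.
Qed.

Lemma mact_xV n m i z : wact mact (winv (x_ n)) ((m, i), z) = ((m + n%:Z, i), z).
Proof.
have := wactVK mactK (x_ n) ((m + n%:Z, i), z); rewrite mact_x addrK.
by [].
Qed.

Lemma mact_tw n s z : wact mact (tw n) (s, z)
  = (s, if pselect (s = (n%:Z, i0)) then - z else z).
Proof.
case: s => m i; rewrite /tw wact_cat /= mact_x /= mact_xV subrK.
suff -> : ((m - n%:Z, i) = (0, i0)) = ((m, i) = (n%:Z, i0)) by [].
by apply/propext; split=> -[e ->]; congr (_, _); lia.
Qed.

Lemma mact_k j s z : mact (k_ j) (s, z) = (kappa j true s, z).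
Proof. by case: s. Qed.

Lemma mact_u s z : mact u_ (s, z) = (s, if pselect (colour s) then z else z + 1).
Proof. by case: s. Qed.

Lemma relations_model a b : (a, b) \in relations -> wact mact a =1 wact mact b.
Proof.
have kinj j : injective (kappa j true) by exact: (can_inj (@kappaK j false)).
rewrite inE => /orP[/eqP[-> ->] [s z]|/flattenP[l /mapP[j]]].
  rewrite wact_cat wact1 wact_cons mact_tw !mact_u mact_tw; congr (_, _).
  (* [tw h] moves points only above [(h, i0)], where [u_] acts trivially because the site is
     coloured. *)
  have hs : s = (h%:Z, i0) -> colour s by move=> ->; exact: reach_refl.
  case: (pselect (colour s)) => c; case: (pselect (s = _)) => e //.
  by case: c; exact: hs.
rewrite mem_iota => /andP[_ js] ->.
case e : (nth _ rs j) => [[m r] [A B]]; have [k1 k2 k3] := kappaP js e.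
rewrite !inE => /or3P[] /eqP[-> ->] [s z].
- move: s => [n i]; rewrite wact_cat wact1 wact_cons mact_x !mact_k k2.
  by case: (kappa j true (n, i)) => n' i'; rewrite mact_x.
- rewrite wact_cat wact1 wact_cons mact_tw !mact_k mact_tw; congr (_, _).
  suff -> : (s = (r%:Z, i0)) = (kappa j true s = (B%:Z, i0)) by [].
  by rewrite -k1; apply/propext; split=> [->|/kinj].
- by rewrite !(wact_cons, wact1, mact_k, mact_u) k3.
Qed.

Definition expo (w : word) : int := \sum_(l <- w) (if l.2 then 1 else -1).

Lemma mact_expo w s z : all (fun l => l.1 == 1%N) w ->
  wact mact w (s, z) = (s, if pselect (colour s) then z else z + expo w).
Proof.
rewrite /expo; elim: w z => [|l w IH] z /=.
  by move=> _; rewrite big_nil addr0; case: pselect.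
case/andP=> /eqP l1 hw; rewrite IH // big_cons /mact l1; case: s {IH} => n i.
by case: pselect => //= c; case: (l.2); congr (_, _); ring.
Qed.

Lemma expo_reduced w : all (fun l => l.1 == 1%N) w -> reduced w -> expo w = 0 -> w = [::].
Proof.
case: w => // l w; case: l => i b /= /andP[/eqP -> hw] hr.
suff -> : expo ((1%N, b) :: w) = (if b then 1 else -1) *+ (size w).+1.
  by case: b {hr} => /eqP; rewrite ?mulNrn ?oppr_eq0 natz.
elim: w b hw hr {i} => [|[j c] w IH] b; first by rewrite /expo big_seq1.
case/andP=> /= /eqP -> hw; rewrite /reduced /= => /andP[hbc hr].
have ebc : c = b by case: b c hbc {hr} => -[].
rewrite ebc in hr *; rewrite /expo big_cons -/(expo _) IH // mulrS.
Qed.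

(** The equation is evaluated at height 0 above two sites at position 0. In the sheet [i0] the
    reflection makes it [expo v = - expo w]; in a sheet without colours it reads
    [expo v = expo w]. *)
Lemma model_independent n v w : ~ reach rs n h ->
  all (fun l => l.1 == 1%N) v -> all (fun l => l.1 == 1%N) w ->
  (forall p, wact mact (x_ n ++ v ++ winv (x_ n)) p
     = wact mact (t_ :: x_ n ++ w ++ winv (x_ n) ++ [:: linv t_]) p) ->
  expo v = 0 /\ expo w = 0.
Proof.
move=> nn hv hw H.
have V (u : word) i z : all (fun l : letter => l.1 == 1%N) u ->
    wact mact (x_ n ++ u ++ winv (x_ n)) ((0, i), z) =
    ((0, i), if pselect (colour (n%:Z, i)) then z else z + expo u).
  by move=> hu; rewrite !wact_cat mact_xV mact_expo // mact_x add0r subrr.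
have T b z i : mact (2%N, b) ((0, i), z) = ((0, i), if pselect ((0 : int, i) = (0, i0)) then - z else z).
  by [].
have S i : (0 : int, i, if pselect (colour (n%:Z, i)) then 0 else expo v) =
    (0 : int, i, let z := if pselect (colour (n%:Z, i)) then 0 else expo w in
           if pselect ((0 : int, i) = (0, i0)) then - z else z).
  have := H ((0, i), 0); rewrite V // add0r => ->.
  rewrite wact_cons (_ : x_ n ++ _ = (x_ n ++ w ++ winv (x_ n)) ++ [:: linv t_]);
    last by rewrite -!catA.
  have Z (b : bool) : (if b then - 0 else 0) = 0 :> int by case: b; rewrite ?oppr0.
  rewrite wact_cat wact1 T Z.
  by rewrite V // T add0r.
have /= e1 := congr1 snd (S i0); have /= e2 := congr1 snd (S (fun=> False, [::])).
rewrite !(@if_false (colour (n%:Z, i0))) // if_true // in e1.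
rewrite !if_false // in e2; last first.
  by move=> [e]; have : halting h%:Z by [exact: reach_refl]; rewrite -e.
by split; lia.
Qed.

End Model.

(** * The matrix group attached to a rewriting system *)

Local Open Scope ring_scope.

Section InGen.
Variables (n : nat) (X : seq 'M[rat]_n).
Hypothesis Xunit : all (fun x => x \in unitmx) X.

Lemma in_gen_unit g : in_gen X g -> g \in unitmx.
Proof.
elim=> [|x {}g hx _ IH|x {}g hx _ IH]; first exact: unitmx1.
  by rewrite unitmx_mul IH andbT (allP Xunit).
by rewrite unitmx_mul IH andbT unitmx_inv (allP Xunit).
Qed.

Lemma in_gen_mul g g' : in_gen X g -> in_gen X g' -> in_gen X (g *m g').
Proof.
move=> hg hg'; elim: hg => [|x {}g hx _ IH|x {}g hx _ IH]; rewrite ?mul1mx -?mulmxA //.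
  exact: gen_mul.
exact: gen_mulV.
Qed.

Lemma in_gen_base x : x \in X -> in_gen X x.
Proof. by move=> hx; rewrite -[x]mulmx1; apply: gen_mul => //; apply: gen_one. Qed.

Lemma invmxM (A B : 'M[rat]_n) : A \in unitmx -> B \in unitmx ->
  invmx (A *m B) = invmx B *m invmx A.
Proof.
move=> hA hB; have hAB : A *m B \in unitmx by rewrite unitmx_mul hA hB.
by rewrite -[RHS]mulmx1 -(mulmxV hAB) !mulmxA mulmxKV // mulVmx // mul1mx.
Qed.

Lemma in_gen_inv g : in_gen X g -> in_gen X (invmx g).
Proof.
elim=> [|x {}g hx hg IH|x {}g hx hg IH]; first by rewrite invmx1; exact: gen_one.
  rewrite invmxM ?(in_gen_unit hg) ?(allP Xunit) //; apply: in_gen_mul IH _.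
  by rewrite -[invmx x]mulmx1; apply: gen_mulV => //; apply: gen_one.
rewrite invmxM ?(in_gen_unit hg) ?unitmx_inv ?(allP Xunit) // invmxK.
exact/in_gen_mul/in_gen_base.
Qed.

End InGen.

(** * Pairs of plane matrices as block matrices *)

Section Blocks.
Variable m : nat.

Definition blk (a b : 'M[rat]_2) : 'M[rat]_(2 + (2 + m)) :=
  block_mx a 0 0 (block_mx b 0 0 1%:M).

Lemma blkM a b a' b' : blk a b *m blk a' b' = blk (a *m a') (b *m b').
Proof.
by rewrite /blk !mulmx_block !(mulmx0, mul0mx, addr0, add0r, mulmx1).
Qed.

Lemma blk1 : blk 1%:M 1%:M = 1%:M.
Proof. by rewrite /blk -!scalar_mx_block. Qed.

Lemma blk_inj a b a' b' : blk a b = blk a' b' -> a = a' /\ b = b'.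
Proof. by move=> /eq_block_mx [-> _ _ /eq_block_mx [->]]. Qed.

Definition vec2 (v : 'cV[rat]_2) : 'cV[rat]_(2 + (2 + m)) := col_mx v (col_mx v 0).

Lemma blk_vec2 a b v : blk a b *m vec2 v = vec2 v -> a *m v = v /\ b *m v = v.
Proof.
rewrite /blk /vec2 !mul_block_col !(mul0mx, mulmx0, addr0, add0r).
by case/eq_col_mx => -> /eq_col_mx [->].
Qed.

Lemma blk_vec2_fix a v : a *m v = v -> blk a a *m vec2 v = vec2 v.
Proof.
by move=> h; rewrite /blk /vec2 !mul_block_col !(mul0mx, mulmx0, addr0, add0r) h.
Qed.

End Blocks.

Section Reduction.
Variables (rs : seq rule) (h m : nat).
Hypothesis rs_wf : forall m r A B, (m, r, (A, B)) \in rs -> (r < m)%N /\ (B < A)%N.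
Hypothesis rs_closed : forall m r A B v, (m, r, (A, B)) \in rs ->
  (reach rs (m * v + r) h <-> reach rs (A * v + B) h).

Let q := (size rs + 3)%N.
Local Notation rho := (rho q).
Local Notation blk := (@blk m).

(* With [H] the group presented by [relations], these generate the pairs [(a, b)]
   such that [a = t b t^-1] in [H]. *)
Definition gens : seq 'M[rat]_(2 + (2 + m)) :=
  [seq blk (rho [:: (i, true)]) (rho [:: linv t_; (i, true); t_]) | i <- iota 0 q] ++
  [seq blk 1%:M (rho (ab.1 ++ winv ab.2)) | ab <- relations rs h].

Definition stab_vec n := vec2 m (rho (x_ n) *m uvec).

Lemma rho_nil : rho [::] = 1%:M. Proof. by []. Qed.

Lemma rhoVK w : rho (winv w) *m rho w = 1%:M.
Proof. by apply: mulmx1C; exact: rhoV. Qed.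

Lemma rho_cancel u v w : rho (u ++ v ++ winv v ++ w) = rho (u ++ w).
Proof. by rewrite !rho_cat (mulmxA (rho v)) rhoV mul1mx. Qed.

Lemma rho_cancelV u v w : rho (u ++ winv v ++ v ++ w) = rho (u ++ w).
Proof. by rewrite !rho_cat (mulmxA (rho (winv v))) rhoVK mul1mx. Qed.

Lemma blk_unit a b : blk (rho a) (rho b) \in unitmx.
Proof.
suff: blk (rho a) (rho b) *m blk (rho (winv a)) (rho (winv b)) = 1%:M.
  by case/mulmx1_unit.
by rewrite blkM !rhoV blk1.
Qed.

Lemma invmx_blk a b : invmx (blk (rho a) (rho b)) = blk (rho (winv a)) (rho (winv b)).
Proof.
rewrite -[RHS]mul1mx -(mulVmx (blk_unit a b)) -mulmxA blkM !rhoV blk1 mulmx1.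
by [].
Qed.

Lemma gens_unit : all (fun x => x \in unitmx) gens.
Proof.
apply/allP => x; rewrite mem_cat => /orP[/mapP[i _ ->]|/mapP[ab _ ->]].
  exact: blk_unit.
by have := blk_unit [::] (ab.1 ++ winv ab.2); rewrite rho_nil.
Qed.

Let good (w : word) := all (fun l : letter => (l.1 < q)%N) w.

Lemma good_winv w : good (winv w) = good w.
Proof. by rewrite /good /winv all_rev all_map. Qed.

Lemma good_cat v w : good (v ++ w) = good v && good w.
Proof. exact: all_cat. Qed.

Lemma good_x n : good (x_ n).
Proof. by rewrite /good all_nseq /q /= addn3 orbT. Qed.

Lemma good_tw n : good (tw n).
Proof. by rewrite good_cat good_winv good_x /= -/(good _) good_x /q addn3. Qed.

(** * Deriving consequences of the relations inside the matrix group *)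

Section Derivation.

Definition inG a b := in_gen gens (blk (rho a) (rho b)).
(** Equality of [a] and [b] in [H], witnessed by the pair [(1, a b^-1)]. *)
Definition eqH a b := inG [::] (a ++ winv b).

Lemma inG_cat a b a' b' : inG a b -> inG a' b' -> inG (a ++ a') (b ++ b').
Proof. by move=> h1 h2; rewrite /inG !rho_cat -blkM; apply: in_gen_mul. Qed.

Lemma inG_inv a b : inG a b -> inG (winv a) (winv b).
Proof. by move=> h1; rewrite /inG -invmx_blk; apply: in_gen_inv gens_unit _ _. Qed.

Lemma inG_eq a b a' b' : rho a = rho a' -> rho b = rho b' -> inG a b -> inG a' b'.
Proof. by rewrite /inG => -> ->. Qed.

Lemma inG_nil : inG [::] [::].
Proof. by rewrite /inG rho_nil blk1; exact: gen_one. Qed.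

Lemma inG_diag a : good a -> inG a (linv t_ :: a ++ [:: t_]).
Proof.
elim: a => [|l a IH].
  by move=> _; apply: (inG_eq _ _ inG_nil) => //; rewrite rho_nil -(rhoV q [:: linv t_]) -rho_cat.
case/andP=> hl /IH ha.
have hl1 : inG [:: l] [:: linv t_; l; t_].
  have base i : (i < q)%N -> inG [:: (i, true)] [:: linv t_; (i, true); t_].
    move=> hi; apply: in_gen_base; rewrite mem_cat; apply/orP; left.
    by apply/mapP; exists i; rewrite ?mem_iota.
  by case: l hl => i [] /base // /inG_inv.
apply: inG_eq (inG_cat hl1 ha) => //.
exact: (rho_cancel [:: linv t_; l] [:: t_] (a ++ [:: t_])).
Qed.

(** [(1, w)] is conjugated by the pair that [inG_diag] gives for [t c t^-1], whose second component
    reduces to [c]. Thus the relators yield their whole normal closure. *)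
Lemma inG_conj c w : good c -> inG [::] w -> inG [::] (c ++ w ++ winv c).
Proof.
move=> hc hw; have ht : good (t_ :: c ++ [:: linv t_]).
  by rewrite /good /= all_cat -/(good c) hc /q addn3.
have h1 := inG_diag ht.
apply: inG_eq (inG_cat h1 (inG_cat hw (inG_inv h1))); first by rewrite rho_cat rhoV.
have e : rho (linv t_ :: (t_ :: c ++ [:: linv t_]) ++ [:: t_]) = rho c.
  have := rho_cancelV [::] [:: t_] (c ++ [:: linv t_; t_]).
  have := rho_cancelV c [:: t_] [::]; rewrite [in RHS]cats0 => <- e2.
  by apply: etrans e2; congr (rho _); rewrite /= -catA.
have e' : rho (winv (linv t_ :: (t_ :: c ++ [:: linv t_]) ++ [:: t_])) = rho (winv c).
  rewrite -[LHS]mulmx1 -(rhoV q c) -e mulmxA rhoVK mul1mx.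
  by [].
by rewrite !rho_cat e e'.
Qed.

Lemma eqH_rho a b a' b' : rho a = rho a' -> rho b = rho b' -> eqH a b -> eqH a' b'.
Proof.
move=> ea eb; apply: inG_eq => //; rewrite !rho_cat ea; congr (_ *m _).
by rewrite -[LHS]mulmx1 -(rhoV q b') -eb mulmxA rhoVK mul1mx.
Qed.

Lemma eqH_refl a : eqH a a.
Proof. by apply: (inG_eq _ _ inG_nil) => //; rewrite rho_cat rhoV. Qed.

Lemma winvK : involutive winv.
Proof. by move=> w; rewrite /winv map_rev revK -map_comp map_id_in // => l _; exact: linvK. Qed.

Lemma eqH_sym a b : eqH a b -> eqH b a.
Proof. by move/inG_inv; rewrite winv_cat winvK. Qed.

Lemma eqH_trans b a c : eqH a b -> eqH b c -> eqH a c.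
Proof.
move=> h1 h2; apply: inG_eq (inG_cat h1 h2) => //.
by rewrite !rho_cat -mulmxA (mulmxA (rho (winv b))) rhoVK mul1mx.
Qed.

Lemma eqH_ctx c d a b : good c -> eqH a b -> eqH (c ++ a ++ d) (c ++ b ++ d).
Proof.
move=> hc hab; apply: inG_eq (inG_conj hc hab) => //.
by rewrite !winv_cat !rho_cat -!mulmxA (mulmxA (rho d)) rhoV mul1mx.
Qed.

Definition intertwines k a b := eqH (k ++ a) (b ++ k).

Lemma intertwines_cat k a b a' b' : good b ->
  intertwines k a b -> intertwines k a' b' -> intertwines k (a ++ a') (b ++ b').
Proof.
move=> gb h1 h2; have := @eqH_ctx [::] a' _ _ isT h1; have := eqH_ctx [::] gb h2.
rewrite /= -!catA !cats0 => {}h2 {}h1; apply: eqH_trans h1 _.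
by rewrite /intertwines -catA.
Qed.

Lemma intertwines_inv k a b : good b -> intertwines k a b -> intertwines k (winv a) (winv b).
Proof.
move=> gb h1; have gb' : good (winv b) by rewrite good_winv.
have := eqH_sym (eqH_ctx (winv a) gb' h1); apply: eqH_rho.
  by rewrite !rho_cat !mulmxA rhoVK mul1mx.
by rewrite !rho_cat -!mulmxA rhoV mulmx1.
Qed.

Lemma intertwines_eq k a b : good k -> eqH a b -> intertwines k a a -> intertwines k b b.
Proof.
move=> gk ab kaa; have := eqH_ctx [::] gk ab; rewrite !cats0 => /eqH_sym h1.
apply: eqH_trans h1 (eqH_trans kaa _).
exact: (@eqH_ctx [::] k _ _ isT ab).
Qed.

Lemma eqH_relation a b : (a, b) \in relations rs h -> eqH a b.
Proof.
move=> hab; apply: in_gen_base; rewrite mem_cat; apply/orP; right.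
by apply/mapP; exists (a, b).
Qed.

Lemma x_D a b : x_ (a + b) = x_ a ++ x_ b.
Proof. by rewrite /x_ nseqD. Qed.

Lemma tw_shift a r : tw (a + r) = winv (x_ a) ++ tw r ++ x_ a.
Proof. by rewrite /tw -!catA /= -x_D addnC x_D winv_cat -catA. Qed.

Lemma good_k j : (j < size rs)%N -> good [:: k_ j].
Proof. by rewrite /good /= /q addn3 andbT. Qed.

(** Induction back from [h]: [k_j] carries [t(m v + r)] to [t(A v + B)] and commutes with [u], so
    commutation of [u] with the latter gives it for the former. *)
Lemma commute_u n : reach rs n h -> intertwines [:: u_] (tw n) (tw n).
Proof.
suff gen k : reach rs n k -> k = h -> intertwines [:: u_] (tw n) (tw n) by move/gen; apply.
elim=> {n k} [n ->|m' r A B v k hr _ IH /IH {}IH].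
  by apply: eqH_relation; rewrite inE eqxx.
have hj : (index (m', r, (A, B)) rs < size rs)%N by rewrite index_mem.
set j := index _ _ in hj; have ej : nth (0, 0, (0, 0))%N rs j = (m', r, (A, B)) by rewrite nth_index.
have gk := good_k hj.
have rel a b : (a, b) \in rule_rels j (m', r, (A, B)) -> eqH a b.
  move=> hab; apply: eqH_relation; rewrite inE; apply/orP; right.
  by apply/flattenP; exists (rule_rels j (m', r, (A, B))) => //; apply/mapP; exists j; rewrite ?mem_iota ?ej.
have kx : intertwines [:: k_ j] (x_ m') (x_ A) by apply: rel; rewrite !inE eqxx.
have kt : intertwines [:: k_ j] (tw r) (tw B) by apply: rel; rewrite !inE eqxx orbT.
have uk : intertwines [:: u_] [:: k_ j] [:: k_ j] by apply: rel; rewrite !inE eqxx !orbT.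
have kxv : intertwines [:: k_ j] (x_ (m' * v)) (x_ (A * v)).
  elim: v {IH} => [|v IHv]; first by rewrite !muln0 /intertwines cats0; exact: eqH_refl.
  by rewrite !mulnS !x_D; apply: intertwines_cat => //; exact: good_x.
have kt' : intertwines [:: k_ j] (tw (m' * v + r)) (tw (A * v + B)).
  rewrite !tw_shift; apply: intertwines_cat; rewrite ?good_winv ?good_x //.
    by apply: intertwines_inv kxv; exact: good_x.
  by apply: intertwines_cat => //; exact: good_tw.
have gk' : good (winv [:: k_ j]) by rewrite good_winv.
apply: (@intertwines_eq _ (winv [:: k_ j] ++ tw (A * v + B) ++ [:: k_ j])).
- by rewrite /good /= /q addn3.
- have := eqH_sym (eqH_ctx [::] gk' kt'); rewrite !cats0; apply: eqH_rho => //.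
  exact: (rho_cancelV [::] [:: k_ j] (tw (m' * v + r))).
- apply: intertwines_cat => //; first exact: intertwines_inv.
  by apply: intertwines_cat => //; exact: good_tw.
Qed.

(** [(a, a)] is the product of [(a, t^-1 a t)] and [(1, t^-1 a^-1 t a)], and [t^-1 a^-1 t a] is
    trivial in [H]. *)
Lemma inG_swap a : good a -> eqH (a ++ [:: t_]) ([:: t_] ++ a) -> inG a a.
Proof.
move=> ga hat.
have gat : good (winv (a ++ [:: t_])).
  by rewrite good_winv good_cat ga /good /= /q addn3.
have hN : eqH ([:: linv t_] ++ winv a ++ [:: t_] ++ a) [::].
  have := eqH_ctx [::] gat (eqH_sym hat); apply: eqH_rho.
    by congr (rho _); rewrite cats0 winv_cat -catA.
  exact: (rho_cancelV [::] (a ++ [:: t_]) [::]).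
have := inG_cat (inG_diag ga) hN; apply: inG_eq; rewrite ?cats0 //.
have e1 := rho_cancel ([:: linv t_] ++ a) [:: t_] (winv a ++ [:: t_] ++ a).
have e2 := rho_cancel [:: linv t_] a ([:: t_] ++ a).
have e3 := rho_cancelV [::] [:: t_] a.
apply: etrans (etrans e1 (etrans _ (etrans e2 e3))); congr (rho _).
by rewrite /= -!catA.
Qed.

(** The witness is [(a, a)] with [a = x^n u x^-n], which commutes with [t] since [u] commutes with
    [x^-n t x^n]. *)
Lemma stab_nontrivial n : reach rs n h -> ~ stabilizer_trivial gens (stab_vec n).
Proof.
move=> /commute_u hn hs; set X := x_ n; have gX : good X := good_x n.
pose a := X ++ [:: u_] ++ winv X.
have ga : good a by rewrite !good_cat gX good_winv gX /good /= /q addn3.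
have hg : inG a a.
  apply: inG_swap => //; have := eqH_ctx (winv X) gX hn; apply: eqH_rho.
    apply: etrans (etrans (rho_cancel (X ++ [:: u_] ++ winv X ++ [:: t_]) X [::]) _);
      congr (rho _); by rewrite /a /tw -/X ?cats0 -?catA /= -?catA /= -?catA.
  apply: etrans (etrans (rho_cancel [::] X ([:: t_] ++ X ++ [:: u_] ++ winv X)) _);
    congr (rho _); by rewrite /a /tw -/X -?catA /= -?catA /= -?catA.
have fixa : rho a *m (rho X *m uvec) = rho X *m uvec.
  rewrite /a !rho_cat -!mulmxA (mulmxA (rho (winv X))) rhoVK mul1mx.
  by rewrite mul1mx rho_uvec.
have /hs : in_gen gens (blk (rho a) (rho a)) by exact: hg.
move=> /(_ (blk_vec2_fix m fixa)); rewrite -blk1 => /blk_inj [e _].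
have eu : rho1 q u_ = 1%:M.
  have := congr1 (fun M => rho (winv X) *m M *m rho X) e.
  rewrite /= mulmx1 rhoVK /a !rho_cat mulmxA rhoVK mul1mx -mulmxA rhoVK mulmx1.
  by rewrite rho_cons mulmx1.
(* On the test vector [(1, 0)], where [dt (pt 3)] does not vanish, [rho1 q u_ = 1] would give
   [lam = 1]. *)
have := dt_dilation (lam q) (\col_i (if i == 0 then 1 else 0)) (@pdet_neq0 2 3 isT).
rewrite -[dilation _ _ _]/(rho1 q u_) eu mul1mx => -[_].
rewrite /dt !mxE /=; have := lam_gt0 q; rewrite lamE; have := bound_ge1 q.
have := exprn_ege1 4 (bound_ge1 q); lra.
Qed.

End Derivation.

(** * Reading elements of the matrix group in the model *)

Section Independence.

Let act := mact rs_wf rs_closed.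
Let actK l p : act l (act (linv l) p) = p.
Proof. exact: mactK. Qed.

Lemma relations_good ab : ab \in relations rs h -> good ab.1 && good ab.2.
Proof.
have gu : good [:: u_] by rewrite /good /= /q addn3.
rewrite inE => /orP[/eqP->|/flattenP[l /mapP[j]]].
  rewrite -[_.1]/([:: u_] ++ tw h) -[_.2]/(tw h ++ [:: u_]).
  by rewrite (good_cat [:: u_]) (good_cat (tw h)) good_tw gu.
rewrite mem_iota => /andP[_ js] ->; have gk := good_k js.
case e : (nth _ rs j) => [[m' r] [A B]]; rewrite !inE => /or3P[] /eqP->.
- rewrite -[_.1]/([:: k_ j] ++ x_ m') -[_.2]/(x_ A ++ [:: k_ j]).
  by rewrite (good_cat [:: k_ j]) (good_cat (x_ A)) !good_x gk.
- rewrite -[_.1]/([:: k_ j] ++ tw r) -[_.2]/(tw B ++ [:: k_ j]).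
  by rewrite (good_cat [:: k_ j]) (good_cat (tw B)) !good_tw gk.
- rewrite -[_.1]/([:: u_] ++ [:: k_ j]) -[_.2]/([:: k_ j] ++ [:: u_]).
  by rewrite (good_cat [:: u_]) (good_cat [:: k_ j]) gk gu.
Qed.

(** The model acts through words and a matrix comes without one, hence the existential
    quantifiers. *)
Definition inS g := exists a b, [/\ good a, good b, g = blk (rho a) (rho b)
  & forall p, wact act a p = wact act (t_ :: b ++ [:: linv t_]) p].

Lemma inS_mul g g' : inS g -> inS g' -> inS (g *m g').
Proof.
move=> [a [b [ga gb -> hab]]] [a' [b' [ga' gb' -> hab']]].
exists (a ++ a'), (b ++ b'); rewrite !good_cat ga gb blkM -!rho_cat; split=> // p.
rewrite wact_cat hab hab' /= !wact_cat /=; congr (act _ (wact _ _ _)).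
by rewrite -{2}(linvK t_) actK.
Qed.

Lemma inS_inv g : inS g -> inS (invmx g).
Proof.
move=> [a [b [ga gb -> hab]]]; exists (winv a), (winv b).
rewrite !good_winv ga gb invmx_blk; split=> // p.
set c := t_ :: b ++ [:: linv t_] in hab.
have -> : t_ :: winv b ++ [:: linv t_] = winv c by rewrite /c winv_cons winv_cat.
by rewrite -{1}(wactV actK c p) -hab (wactVK actK).
Qed.

Lemma inS_gens x : x \in gens -> inS x.
Proof.
rewrite mem_cat => /orP[/mapP[i]|/mapP[[a b] hab ->]].
  rewrite mem_iota => /andP[_ hi] ->; exists [:: (i, true)], [:: linv t_; (i, true); t_].
  have tq : (2 < q)%N by rewrite /q addn3.
  split; rewrite /good /= ?hi ?tq // => p.
  by rewrite [in RHS]actK actK.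
have /andP[ga gb] := relations_good hab.
exists [::], (a ++ winv b); rewrite good_cat good_winv; split=> //; first exact/andP.
move=> p; rewrite /= -catA !wact_cat (relations_model rs_wf rs_closed hab).
by rewrite wactV ?actK //; exact: actK.
Qed.

Lemma in_gen_inS g : in_gen gens g -> inS g.
Proof.
elim=> [|x {}g hx _ IH|x {}g hx _ IH].
- by exists [::], [::]; split=> //; [rewrite blk1|move=> p /=; rewrite actK].
- by apply: inS_mul IH; exact: inS_gens.
- by apply: inS_mul IH; apply: inS_inv; exact: inS_gens.
Qed.

(** Both components fix [rho X *m uvec], so [stab_uvec] writes them as [x^n v x^-n] and [x^n w x^-n]
    with [v], [w] powers of [u]; the model makes both exponents zero. *)
Lemma stab_trivial n : ~ reach rs n h -> stabilizer_trivial gens (stab_vec n).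
Proof.
move=> nr g /in_gen_inS [a [b [ga gb -> hab]]] /blk_vec2 [fa fb].
set X := x_ n in fa fb.
have key c : good c -> rho c *m (rho X *m uvec) = rho X *m uvec ->
   exists v, [/\ all (fun l : letter => l.1 == 1%N) v, reduced v, rho (X ++ v ++ winv X) = rho c
     & forall p, wact act (X ++ v ++ winv X) p = wact act c p].
  move=> gc fc; exists (reduce (winv X ++ c ++ X)); split.
  - apply: (@stab_uvec q); first exact: reduce_reduced.
    + by apply: reduce_all; rewrite -/(good _) !good_cat good_winv gc good_x.
    + by rewrite /q addn3.
    + by rewrite rho_reduce !rho_cat -!mulmxA fc mulmxA rhoVK mul1mx.
  - exact: reduce_reduced.
  - rewrite !rho_cat rho_reduce !rho_cat !mulmxA rhoV mul1mx -mulmxA rhoV mulmx1.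
    by [].
  - by move=> p; rewrite !wact_cat (wact_reduce actK) !wact_cat !wactV //; exact: actK.
have [v [uv rv ev av]] := key a ga fa; have [w [uw rw ew aw]] := key b gb fb.
have [v0 w0] : expo v = 0 /\ expo w = 0.
  apply: (model_independent (rs_wf := rs_wf) (rs_closed := rs_closed) nr uv uw) => p.
  rewrite -/act av hab /= !wact_cat; congr (act _ _).
  by rewrite -aw !wact_cat.
rewrite -ev -ew (expo_reduced uv rv v0) (expo_reduced uw rw w0) /=.
by rewrite rho_cat rhoV blk1.
Qed.

End Independence.

End Reduction.

Local Close Scope ring_scope.

(** * Computability of the encoding and the diagonal argument *)

Definition computable2 (f : nat -> nat -> nat) :=
  exists p, forall a b, prf_eval p [:: a; b] (f a b).

Lemma eval_comp1 p p1 v y z : prf_eval p1 v y -> prf_eval p [:: y] z ->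
  prf_eval (PComp p [:: p1]) v z.
Proof. by move=> h1 h; exact: ev_comp (evs_cons h1 (evs_nil _)) h. Qed.

Lemma eval_comp2 p p1 p2 v y1 y2 z : prf_eval p1 v y1 -> prf_eval p2 v y2 ->
  prf_eval p [:: y1; y2] z -> prf_eval (PComp p [:: p1; p2]) v z.
Proof. by move=> h1 h2 h; exact: ev_comp (evs_cons h1 (evs_cons h2 (evs_nil _))) h. Qed.

Lemma eval_proj i v y : (i < size v)%N -> nth 0 v i = y -> prf_eval (PProj i) v y.
Proof. by move=> hi <-; constructor. Qed.

Lemma eval_const c : exists p, forall v, prf_eval p v c.
Proof.
elim: c => [|c [p hp]]; first by exists PZero => v; constructor.
by exists (PComp PSucc [:: p]) => v; apply: eval_comp1 (hp v) _; constructor.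
Qed.

Lemma eval_prim f g (F : nat -> nat -> nat) :
  (forall y, prf_eval f [:: y] (F 0 y)) ->
  (forall k y, prf_eval g [:: k; F k y; y] (F k.+1 y)) ->
  forall x y, prf_eval (PPrim f g) [:: x; y] (F x y).
Proof.
move=> h0 hS; elim=> [|k IH] y; first by apply: ev_prim0.
exact: ev_primS (IH y) (hS k y).
Qed.

Lemma computable_const c : computable2 (fun _ _ => c).
Proof. by have [p hp] := eval_const c; exists p. Qed.

Lemma computable_fst : computable2 (fun a _ => a).
Proof. by exists (PProj 0) => a b; apply: eval_proj. Qed.

Lemma computable_snd : computable2 (fun _ b => b).
Proof. by exists (PProj 1) => a b; apply: eval_proj. Qed.

Lemma computable_op op f g : computable2 op -> computable2 f -> computable2 g ->
  computable2 (fun a b => op (f a b) (g a b)).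
Proof.
move=> [p hp] [pf hf] [pg hg]; exists (PComp p [:: pf; pg]) => a b.
exact: eval_comp2 (hf a b) (hg a b) (hp _ _).
Qed.

Lemma computable_addn : computable2 addn.
Proof.
exists (PPrim (PProj 0) (PComp PSucc [:: PProj 1])); apply: eval_prim => [y|k y].
  exact: eval_proj.
apply: (eval_comp1 (y := k + y)); first exact: eval_proj.
by rewrite addSn; constructor.
Qed.

Lemma computable_muln : computable2 muln.
Proof.
have [p hp] := computable_addn.
exists (PPrim PZero (PComp p [:: PProj 2; PProj 1])); apply: eval_prim => [y|k y].
  exact: ev_zero.
apply: (eval_comp2 (y1 := y) (y2 := k * y)); try exact: eval_proj.
by rewrite mulSn.
Qed.

Lemma computable_expn : computable2 (fun x b => b ^ x).
Proof.
have [p hp] := computable_muln; have [p1 hp1] := eval_const 1.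
exists (PPrim p1 (PComp p [:: PProj 2; PProj 1])); apply: eval_prim => [y|k y].
  exact: hp1.
apply: (eval_comp2 (y1 := y) (y2 := y ^ k)); try exact: eval_proj.
by rewrite expnS.
Qed.

Lemma computable_exp2 f : computable2 f -> computable2 (fun a b => 2 ^ f a b).
Proof. by move=> hf; apply: (computable_op computable_expn hf (computable_const 2)). Qed.

Lemma computable_code (T : Type) (s : seq T) (F : T -> nat -> nat -> nat) :
  (forall i, computable2 (F i)) ->
  computable2 (fun a b => CodeSeq.code [seq F i a b | i <- s]).
Proof.
move=> hF; elim: s => [|i s IH] /=; first exact: computable_const.
(* [CodeSeq.code (c :: s)] is [2 ^ c * (1 + 2 * CodeSeq.code s)]. *)
have hd := computable_op computable_addn IH IH.
have hS := computable_op computable_addn (computable_const 1) hd.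
have [p hp] := computable_op computable_muln (computable_exp2 (hF i)) hS.
by exists p => a b; have := hp a b; rewrite add1n addnn.
Qed.

Lemma computable_code2 f g : computable2 f -> computable2 g ->
  computable2 (fun a b => CodeSeq.code [:: f a b; g a b]).
Proof.
move=> hf hg; apply: (@computable_code _ [:: true; false] (fun i => if i then f else g)).
by case.
Qed.

(** * Codes of rational vectors *)

Lemma pickle_pair (T U : countType) (x : T) (y : U) :
  pickle (x, y) = CodeSeq.code [:: pickle x; pickle y].
Proof. by []. Qed.

Definition code_natQ k :=
  CodeSeq.code [:: CodeSeq.code [:: CodeSeq.code [:: k]; 0]; CodeSeq.code [:: CodeSeq.code [:: 1]; 0]].

Lemma pickle_natQ (k : nat) : pickle (k%:R : rat)%R = code_natQ k.
Proof.
have e : valq (k%:R : rat)%R = (Posz k, Posz 1).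
  by rewrite [LHS]surjective_pairing -/(numq _) -/(denq _) pmulrn numq_int denq_int.
rewrite -[LHS]/(pickle (valq (k%:R : rat)%R)) e.
by [].
Qed.

Lemma computable_natQ f : computable2 f -> computable2 (fun a b => pickle ((f a b)%:R : rat)%R).
Proof.
move=> hf; have h1 : computable2 (fun a b => CodeSeq.code [:: f a b]).
  by apply: (@computable_code _ [:: tt] (fun=> f)).
have [p hp] := computable_code2 (computable_code2 h1 (computable_const 0))
  (computable_const (CodeSeq.code [:: CodeSeq.code [:: 1]; 0])).
by exists p => a b; rewrite pickle_natQ; exact: hp.
Qed.

(** A column is coded through its graph, a list of pairs of an index and an entry. *)
Lemma pickle_col N (u : 'cV[rat]_N) : pickle u = CodeSeq.code
  [seq CodeSeq.code [:: pickle ij; pickle (u ij.1 ij.2)] | ij <- enum {: 'I_N * 'I_1}].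
Proof.
rewrite -[LHS]/(CodeSeq.code (map pickle (codom (total_fun (mx_val u))))).
rewrite codomE -map_comp; congr (CodeSeq.code _); apply: eq_map => -[i j] /=.
rewrite -[LHS]/(CodeSeq.code [:: pickle (i, j); pickle (mx_val u (i, j))]).
by [].
Qed.

Lemma computable_col N (F : 'I_N -> nat -> nat -> nat) (u : nat -> nat -> 'cV[rat]_N) :
  (forall i, computable2 (F i)) -> (forall a b i j, u a b i j = (F i a b)%:R%R) ->
  computable2 (fun a b => pickle (u a b)).
Proof.
move=> hF hu; have [p hp] := @computable_code _ (enum {: 'I_N * 'I_1})
  (fun ij a b => CodeSeq.code [:: pickle ij; pickle ((F ij.1 a b)%:R : rat)%R])
  (fun ij => computable_code2 (computable_const _) (computable_natQ (hF ij.1))).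
exists p => a b; rewrite pickle_col (eq_map (g := fun ij =>
  CodeSeq.code [:: pickle ij; pickle ((F ij.1 a b)%:R : rat)%R])) // => ij.
by rewrite hu.
Qed.

Definition entry (i e : nat) : nat :=
  match i with 0 | 2 => e | 1 | 3 => 2 | _ => 0 end.

Definition entry_vec m (e : nat) : 'cV[rat]_(2 + (2 + m)) := (\col_i (entry i e)%:R)%R.

(** [pt 0] and [pt 1] span the coordinate axes, so generator 0 is [diag(lam, 1)] and [x^n] maps
    [(1, 2)] to [(lam^n, 2)]. *)
Lemma stab_vecE (rs : seq rule) m n :
  stab_vec rs m n = entry_vec m ((4 * (2 * (size rs + 3) + 1) ^ 4 + 1) ^ n).
Proof.
set L := (4 * _ + 1)%N; set q := (size rs + 3)%N.
have e : (rho q (x_ n) *m uvec = \col_i (if i == 0 then (L ^ n)%:R else 2) :> 'cV[rat]_2)%R.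
  rewrite rhoE; elim: n => [|n IH] /=; first by [].
  rewrite /x_ /= in IH *; rewrite IH /act1; apply/matrixP => i j; rewrite !mxE.
  have -> : ((L ^ n.+1)%:R = lam q * (L ^ n)%:R :> rat)%R by rewrite expnS natrM.
  rewrite !big_ord_recl big_ord0 !mxE /=.
  by case: (i == 0)%R; rewrite /pdet /pt /=; field.
rewrite /stab_vec e /vec2 /entry_vec; apply/matrixP => i j; rewrite !mxE.
case: splitP => [k ->|k ->]; rewrite !mxE; first by case: k => -[|[|]].
by case: splitP => [l ->|l ->]; rewrite !mxE; first by case: l => -[|[|]].
Qed.

Theorem theorem3 (n : nat) (hn : (9 <= n)%N) :
  ~ decidable_promise (@stab_promise n) (@stab_trivial_problem n).
Proof.
have [m ->] : exists m, n = (2 + (2 + m))%N by exists (n - 4); lia.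
move=> {n hn} [f hf].
(* The generators enter the machine only through their code [a], and the
   dilation factor through [b], so that the machine can rebuild its own instance. *)
pose e a b := b ^ (2 ^ a * base 1 ^ b).
have ce : computable2 e.
  apply: (computable_op computable_expn _ computable_snd).
  apply: (computable_op computable_muln (computable_exp2 computable_fst)).
  exact: (computable_op computable_expn computable_snd (computable_const (base 1))).
have [p hp] : computable2 (fun a b => CodeSeq.code [:: a; pickle (entry_vec m (e a b))]).
  apply: (computable_code2 computable_fst).
  apply: (@computable_col _ (fun i a b => entry i (e a b))) => [i|a b i j]; last by rewrite mxE.
  case: (val i) => [|[|[|[|k]]]] //=; exact: computable_const.
(* The machine depends on [f] and [p] only. Its rules determine [X], [L] and [K], and [pickle X] and
   [L ^ K] are then fed to it as input. *)
have [rs [K [h [rs_wf rs_closed mach]]]] := modular_machine (PComp f [:: p]).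
pose X := gens rs h m; pose L := 4 * (2 * (size rs + 3) + 1) ^ 4 + 1.
have [halt loop] := mach (pickle X) (L ^ K).
set N := K * _ in halt loop.
have run z : prf_eval f [:: pickle ((X, stab_vec rs m N) : stab_input (2 + (2 + m)))] z ->
    prf_eval (PComp f [:: p]) [:: pickle X; L ^ K] z.
  apply: eval_comp1; have := hp (pickle X) (L ^ K).
  (* The entry of the vector is [L ^ N = (L ^ K) ^ (2 ^ a * base 1 ^ b)], which is why [L ^ K] is
     the second input. *)
  by rewrite /e -expnM -/N -(stab_vecE rs m N) -pickle_pair.
have [ht hnt] := hf (X, stab_vec rs m N) (gens_unit rs h m).
(* Both answers of [f] are refuted: 1 makes [N] reach [h], so the stabilizer is nontrivial; 0
   prevents this, so it is trivial. *)
have [triv|ntriv] := pselect (stab_trivial_problem ((X, stab_vec rs m N) : stab_input (2 + (2 + m)))).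
  exact: (stab_nontrivial (halt (run _ (ht triv))) triv).
exact: ntriv (stab_trivial rs_wf rs_closed (loop (run _ (hnt ntriv)))).
Qed.
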